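(* Let $A\in\mathcal B_\nu^+$ and $0<r_1<r_2<t<t^\star(A)$. There exists a (possibly random) sequence $(\beta_n)_{n\ge0}$, which almost surely tends to $0$, such that $$\sup_{r_1\le s\le r_2}\big|\widehat l_{n,\beta_n,t}(A,s)-l(A,s)\big|\longrightarrow0\quad\text{in }\mathbf P_x\text{-probability when }n\to+\infty,$$ for any $x\in E$.
   Context: Setting. $(\mathcal E,d)$ is a separable metric space and $E\subset\mathcal E$ is open, with Borel $\sigma$-field $\mathcal B(E)$ and boundary $\partial E$. Let $Q$ be a Markov transition kernel on $(E,\mathcal B(E))$, $\lambda:E\times\mathbf R_+\to\mathbf R_+$ (the jump rate) and $t^\star:E\to\,]0,+\infty]$ (the deterministic censorship). On a probability space $(\Omega,\mathcal A,\mathbf P_{\nu_0})$, $(Z_n)_{n\ge0}$ is a Markov chain with kernel $Q$ and initial distribution $\nu_0$, written $Z_n=\psi(Z_{n-1},\varepsilon_{n-1})$ for $n\ge1$, with $\psi$ measurable and $(\varepsilon_n)_{n\ge0}$ i.i.d. The interarrival times satisfy $S_0=0$ and, for $n\ge1$, $S_n=\varphi(Z_{n-1},\delta_{n-1})$ with $\varphi$ measurable and $(\delta_n)_{n\ge0}$ i.i.d., independent of $(\varepsilon_n)_{n\ge0}$; both sequences are independent of $Z_0$. The law of $S_n$, $n\ge1$, is given for $t\ge0$ by $$\mathbf P_{\nu_0}(S_n>t\mid\{Z_i:i\ge0\},S_0,\dots,S_{n-1})=\mathbf P_{\nu_0}(S_n>t\mid Z_{n-1})=\exp\Big(-\int_0^t\lambda(Z_{n-1},s)\,ds\Big)\mathbf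 1_{\{0\le t<t^\star(Z_{n-1})\}}.$$ $\mathbf P_x$ denotes $\mathbf P_{\nu_0}$ with $\nu_0=\delta_{\{x\}}$. Put $G(\xi,t)=\exp(-\int_0^t\lambda(\xi,s)\,ds)$ and $f(\xi,t)=\lambda(\xi,t)G(\xi,t)$. Standing assumptions. $Q$ is diffuse (it does not charge singletons). There is a probability measure $\nu$ such that, for any initial distribution $\nu_0=\delta_{\{x\}}$, $x\in E$, the law $\nu_n$ of $Z_n$ satisfies $\lim_{n}\|\nu_n-\nu\|_{TV}=0$. Moreover: (1) there is $[\lambda]_{Lip}>0$ with $|\lambda(\xi,s)-\lambda(\xi',s)|\le[\lambda]_{Lip}\,d(\xi,\xi')$ for all $\xi,\xi'\in E$, $s\ge0$; (2) there is a locally integrable $M:\mathbf R_+\to\mathbf R_+$ with $\lambda(\xi,s)\le M(s)$ for all $\xi\in E$, $s\ge0$; (3) $f$ is continuous in time; (4) $f$ is bounded; (5) $t^\star$ is continuous. $K$ is a continuous kernel (a real function with $\int K=1$) with support $[-1,1]$. Notation. $\mathcal B_\nu^+=\{A\in\mathcal B(E): A\text{ relatively compact},\ \nu(A)>0,\ \overline A\cap\partial E=\emptyset\}$; $t^\star(A)=\inf_{\xi\in A}t^\star(\xi)$. For $0\le t<t^\star(A)$: $Y_n(A,t)=\sum_{i=0}^{n-1}\mathbf 1_{\{S_{i+1}\ge t\}}\mathbf 1_{\{Z_i\in A\}}$; $Y_n(A,t)^+=1/Y_n(A,t)$ if $Y_n(A,t)\ne0$ and $0$ otherwise; $N_n(A,t)=\sum_{i=0}^{n-1}\mathbf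 1_{\{S_{i+1}\le t\}}\mathbf 1_{\{Z_i\in A\}}$; $l(A,t)=\int_A f(z,t)\nu(dz)\big/\int_A G(z,t)\nu(dz)$; $\widehat L_n(A,t)=\int_0^tY_n(A,s)^+\,dN_n(A,s)$. For $b>0$ and $0<t<t^\star(A)$, $$\forall\,0\le u\le t,\quad\widehat l_{n,b,t}(A,u)=\frac1b\int_0^tK\Big(\frac{u-s}b\Big)\,d\widehat L_n(A,s).$$ *)

(* Defs.v *)
From HB Require Import structures.
From mathcomp Require Import all_boot all_order all_algebra.
From mathcomp Require Import all_classical all_reals all_analysis.
From mathcomp Require Import measurable_realfun.

Set Implicit Arguments.
Unset Strict Implicit.
Unset Printing Implicit Defensive.

Import Order.TTheory GRing.Theory Num.Theory.
Import numFieldNormedType.Exports.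

Local Open Scope classical_set_scope.
Local Open Scope ring_scope.

(** A set [E] of a metric space as a type, with the subspace topology and its
    Borel sigma-algebra. The point [e0] is only there because measurable types
    are pointed: neither the topology nor the sigma-algebra depends on it. *)
Section state_space.
Context {R : realType} {X : metricType R} {E : set X}.

Definition state (e0 : E) : Type := set_type E.

Variable e0 : E.

HB.instance Definition _ := PseudoMetric.copy (state e0) (set_type E).
HB.instance Definition _ := isPointed.Build (state e0) e0.
HB.instance Definition _ := @isMeasurable.Build
  (sigma_display (@open (state e0))) (state e0)
  <<s @open (state e0) >> (@sigma_algebra0 _ setT _)
  (@sigma_algebraC (state e0) _) (@sigma_algebra_bigcup _ setT _).

Definition point_of (x : state e0) : X := set_val (x : set_type E).

End state_space.
Arguments point_of {R X E e0} x.

Definition boundary {T : topologicalType} (A : set T) : set T :=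
  closure A `\` interior A.

Definition separable (T : topologicalType) : Prop :=
  exists D : set T, countable D /\ dense D.

Section probability_notions.
Context {d} {Om : measurableType d} {R : realType}.
Local Open Scope ereal_scope.

Definition events d' (T : measurableType d') (X : nat -> Om -> T)
    (J : set nat) : set (set Om) :=
  \bigcup_(j in J) preimage_set_system setT (X j) measurable.

(** [g] is a version of the conditional probability of [B] given the
    sigma-algebra [G]. *)
Definition is_cond_prob (P : probability Om R) (G : set (set Om)) (B : set Om)
    (g : Om -> \bar R) : Prop :=
  preimage_set_system setT g measurable `<=` G /\
  (forall C, G C -> P (B `&` C) = \int[P]_(w in C) g w).

Definition independent (P : probability Om R) (F G : set (set Om)) : Prop :=
  forall A B, F A -> G B -> P (A `&` B) = P A * P B.

Definition iid d' (T : measurableType d') (P : probability Om R)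
    (X : nat -> Om -> T) : Prop :=
  (forall (J : seq nat) (B : nat -> set T), uniq J ->
     (forall j, measurable (B j)) ->
     P (\bigcap_(j in [set` J]) (X j @^-1` B j)) =
     \prod_(j <- J) P (X j @^-1` B j)) /\
  (forall n (B : set T), measurable B ->
     P (X n @^-1` B) = P (X 0%N @^-1` B)).

Definition markov_chain d' (T : measurableType d') (P : probability Om R)
    (mu0 : probability T R) (Q : R.-pker T ~> T) (Z : nat -> Om -> T) : Prop :=
  [/\ forall n, measurable_fun setT (Z n),
      forall B, measurable B -> P (Z 0%N @^-1` B) = mu0 B &
      forall n B, measurable B ->
        is_cond_prob P <<s events Z `I_n.+1 >> (Z n.+1 @^-1` B)
          (fun w => Q (Z n w) B)].

Definition tv_dist d' (T : measurableType d') (mu mu' : set T -> \bar R) :=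
  ereal_sup [set `|mu B - mu' B| | B in measurable].

Definition cvg_in_probability0 (P : probability Om R)
    (X : nat -> Om -> \bar R) : Prop :=
  forall e : R, (0 < e)%R -> P [set w | e%:E < `|X n w| ] @[n --> \oo] --> 0.

End probability_notions.

(** Everything in this section is computed along one sample path: [z i] is the
    value of $Z_i$, [s i] that of $S_i$. Interarrival times may be infinite,
    which happens when both the censorship is $+\infty$ and the jump rate is
    integrable. *)
Section estimators.
Context {R : realType} {T : Type}.
Implicit Types (A : set T) (z : nat -> T) (s : nat -> \bar R) (n : nat).

Definition at_risk A z s n (t : R) : R :=
  \sum_(i < n) (t%:E <= s i.+1)%E%:R * \1_A (z i).

Definition at_risk_inv A z s n (t : R) : R :=
  if at_risk A z s n t != 0 then (at_risk A z s n t)^-1 else 0.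

Definition jump_count A z s n (t : R) : R :=
  \sum_(i < n) (s i.+1 <= t%:E)%E%:R * \1_A (z i).

Section jump_count_cumulative.
Variables (A : set T) (z : nat -> T) (s : nat -> \bar R) (n : nat).

Lemma jump_count_nd : nondecreasing (jump_count A z s n).
Proof.
move=> x y xy; apply: ler_sum => i _; apply: ler_wpM2r.
  by rewrite indicE ler0n.
rewrite ler_nat; case: (boolP (s i.+1 <= x%:E)%E) => // sx.
by rewrite (le_trans sx)// lee_fin.
Qed.

Lemma jump_count_rc : right_continuous (jump_count A z s n).
Proof.
move=> x; apply: cvg_big => [|i _]; first exact: add_continuous.
apply: cvgMr_tmp.
have [sx|xs] := leP (s i.+1) x%:E.
  apply: cvg_near_cst; near=> y; have -> // : (s i.+1 <= y%:E)%E.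
  by rewrite (le_trans sx)// lee_fin; near: y; exact: nbhs_right_ge.
apply: cvg_near_cst.
case: (s i.+1) xs => [r| |]// xr.
- near=> y; have -> // : (r%:E <= y%:E)%E = false.
  apply/negbTE; rewrite -ltNge lte_fin; near: y.
  exact: nbhs_right_lt.
- by near=> y; rewrite leye_eq.
Unshelve. all: by end_near. Qed.

HB.instance Definition _ :=
  isCumulative.Build R _ R (jump_count A z s n) jump_count_nd jump_count_rc.

End jump_count_cumulative.

End estimators.

Section stieltjes_primitive.
Context {R : realType} (F : cumulative R R) (g : R -> R) (c : R).
Hypotheses (mg : measurable_fun setT g) (g0 : forall x, 0 <= g x)
  (gc : forall x, g x <= c).

Let mu := lebesgue_stieltjes_measure F.
Let H (t : R) : R := \int[mu]_(v in `]0, t]) g v.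

Let muE (x y : R) : x <= y -> mu `]x, y]%classic = (F y - F x)%:E.
Proof.
move=> xy; rewrite /mu /lebesgue_stieltjes_measure /measure_extension/=.
by rewrite measurable_mu_extE/= ?wlength_itv_bnd//; exact: is_ocitv.
Qed.

Lemma stieltjes_primitive_bound (x y : R) : x <= y ->
  H x <= H y <= H x + c * (F y - F x).
Proof.
move=> xy; set D := `]0, y]%classic `\` `]0, x]%classic.
have mD : measurable D by exact: measurableD.
have DE : `]0, y]%classic = `]0, x]%classic `|` D.
  by rewrite setDUK//; apply: subset_itvl; rewrite bnd_simp.
have Dxy : D `<=` `]x, y]%classic.
  move=> z [/=]; rewrite !in_itv/= => /andP[z0 ->].
  by rewrite z0/= => /negP; rewrite -ltNge andbT.
have ig : mu.-integrable `]0, y]%classic (EFin \o g).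
  apply: measurable_bounded_integrable => //.
  - have [y0|y0] := leP 0 y; first by rewrite [ltLHS]muE// ltry.
    by rewrite set_itv_ge ?measure0// -leNgt bnd_simp ltW.
  - exact: measurable_funTS.
  - exists c; split; first exact: num_real.
    by move=> M cM z _ /=; rewrite ger0_norm// (le_trans (gc z))// ltW.
have HE : H y = H x + \int[mu]_(v in D) g v.
  rewrite /H {1}DE Rintegral_setU//; first by rewrite -DE.
  by apply/disj_setPS => z [? []].
have igD : mu.-integrable D (EFin \o g).
  by apply: integrableS ig => //; exact: subDsetl.
rewrite HE lerDl Rintegral_ge0//= lerD2l.
rewrite -lee_fin fineK; last exact: integrable_fin_num.
have c0 : 0 <= c by rewrite (le_trans (g0 0)).
rewrite (@le_trans _ _ (\int[mu]_(v in D) c%:E)%E)//.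
  apply: ge0_le_integral => //.
  - by move=> z _; rewrite lee_fin.
  - exact/measurable_EFinP/measurable_funTS.
  - by move=> z _; rewrite lee_fin.
rewrite integral_cst// EFinM lee_wpmul2l ?lee_fin//.
by rewrite -muE// le_measure// inE.
Qed.

Lemma stieltjes_primitive_nd : nondecreasing H.
Proof. by move=> x y /stieltjes_primitive_bound/andP[]. Qed.

Lemma stieltjes_primitive_rc : right_continuous H.
Proof.
move=> x.
apply: (@squeeze_cvgr _ _ _ _ (fun=> H x) (fun y => H x + c * (F y - F x))).
- near=> y; apply: stieltjes_primitive_bound.
  by near: y; exact: nbhs_right_ge.
- exact: cvg_cst.
- rewrite -[X in _ --> X]addr0 -[X in _ + X](mulr0 c) -[X in _ * X](subrr (F x)).
  apply: cvgD; first exact: cvg_cst.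
  apply: cvgMl_tmp; apply: cvgB; last exact: cvg_cst.
  exact: cumulative_is_right_continuous.
Unshelve. all: by end_near. Qed.

End stieltjes_primitive.

Section kernel_estimator.
Context {R : realType} {T : Type}.
Variables (A : set T) (z : nat -> T) (s : nat -> \bar R) (n : nat).

Lemma at_risk_nat t : exists m : nat, at_risk A z s n t = m%:R.
Proof.
exists (\sum_(i < n) (t%:E <= s i.+1)%E * (z i \in A))%N.
by rewrite natr_sum; apply: eq_bigr => i _; rewrite natrM indicE.
Qed.

Lemma at_risk_inv_ge0 t : 0 <= at_risk_inv A z s n t.
Proof.
rewrite /at_risk_inv; case: ifPn => // _.
by have [m ->] := at_risk_nat t; rewrite invr_ge0 ler0n.
Qed.

Lemma at_risk_inv_le1 t : at_risk_inv A z s n t <= 1.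
Proof.
rewrite /at_risk_inv; case: ifPn => // + .
have [m ->] := at_risk_nat t; rewrite pnatr_eq0 -lt0n => m0.
by rewrite invf_le1 ?ltr0n// ler1n.
Qed.

Lemma at_risk_ni : nonincreasing_fun (at_risk A z s n).
Proof.
move=> x y xy; apply: ler_sum => i _; apply: ler_wpM2r.
  by rewrite indicE ler0n.
rewrite ler_nat; case: (boolP (y%:E <= s i.+1)%E) => // sy.
by rewrite (le_trans _ sy)// lee_fin.
Qed.

Lemma measurable_at_risk_inv : measurable_fun setT (at_risk_inv A z s n).
Proof.
pose w t := if at_risk A z s n t != 0 then at_risk_inv A z s n t else 1.
have mw : measurable_fun setT w.
  apply: nondecreasing_measurable => // x y xy; rewrite /w.
  have [Yy0|Yy0] := eqVneq (at_risk A z s n y) 0; rewrite /=.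
    by case: ifPn => // _; exact: at_risk_inv_le1.
  have := at_risk_ni xy; move: Yy0; rewrite /at_risk_inv.
  have [k ->] := at_risk_nat x; have [m ->] := at_risk_nat y.
  rewrite !pnatr_eq0 ler_nat => m0 mk; rewrite m0.
  have k0 : (0 < k)%N by rewrite (leq_trans _ mk)// lt0n.
  by rewrite -lt0n k0 lef_pV2 ?posrE ?ltr0n// ?lt0n// ler_nat.
rewrite (_ : at_risk_inv A z s n =
    fun t => if at_risk A z s n t == 0 then 0 else w t); last first.
  by apply/funext => t; rewrite /w /at_risk_inv; case: eqP.
apply: measurable_fun_ifT => //; apply: measurable_fun_eqr => //.
by apply: nonincreasing_measurable => //; exact: at_risk_ni.
Qed.

(** $\int_0^t$ is taken over $]0,t]$; the end point $0$ is immaterial because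
    $S_{i+1} > 0$ almost surely. *)
Definition cum_rate_est (t : R) : R :=
  \int[lebesgue_stieltjes_measure (jump_count A z s n)]_(v in `]0, t])
    at_risk_inv A z s n v.

HB.instance Definition _ := isCumulative.Build R _ R cum_rate_est
  (@stieltjes_primitive_nd _ (jump_count A z s n) _ 1 measurable_at_risk_inv
    at_risk_inv_ge0 at_risk_inv_le1)
  (@stieltjes_primitive_rc _ (jump_count A z s n) _ 1 measurable_at_risk_inv
    at_risk_inv_ge0 at_risk_inv_le1).

Definition rate_est (K : R -> R) (b t u : R) : R :=
  b^-1 * \int[lebesgue_stieltjes_measure cum_rate_est]_(v in `]0, t])
    K ((u - v) / b).

End kernel_estimator.

Section model.
Context {R : realType} {X : metricType R} {E : set X} {e0 : E}.
Context {dO dF dD : measure_display} {Om : measurableType dO}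
  {Fe : measurableType dF} {De : measurableType dD}.
Implicit Types (lambda : state e0 -> R -> R) (tstar : state e0 -> \bar R).

Definition survival lambda (xi : state e0) (t : R) : R :=
  expR (- \int[lebesgue_measure]_(v in `[0, t]) lambda xi v).

Definition jump_density lambda (xi : state e0) (t : R) : R :=
  lambda xi t * survival lambda xi t.

Definition survival_censored lambda tstar (xi : state e0) (t : R) : R :=
  survival lambda xi t * (t%:E < tstar xi)%E%:R.

(** [P nu0] is the probability $\mathbf P_{\nu_0}$ on $\Omega$. *)
Record renewal_model (P : probability (state e0) R -> probability Om R)
    (Q : R.-pker (state e0) ~> (state e0)) lambda tstar
    (psi : state e0 * Fe -> state e0) (phi : state e0 * De -> \bar R)
    (eps : nat -> Om -> Fe) (delta : nat -> Om -> De)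
    (Z : nat -> Om -> state e0) (S : nat -> Om -> \bar R) : Prop := {
  psi_measurable : measurable_fun setT psi ;
  phi_measurable : measurable_fun setT phi ;
  eps_measurable : forall n, measurable_fun setT (eps n) ;
  delta_measurable : forall n, measurable_fun setT (delta n) ;
  Z_markov : forall nu0, markov_chain (P nu0) nu0 Q Z ;
  Z_rec : forall n w, Z n.+1 w = psi (Z n w, eps n w) ;
  S_0 : forall w, S 0%N w = 0%E ;
  S_rec : forall n w, S n.+1 w = phi (Z n w, delta n w) ;
  eps_iid : forall nu0, iid (P nu0) eps ;
  delta_iid : forall nu0, iid (P nu0) delta ;
  noises_independent : forall nu0,
    independent (P nu0) <<s events eps setT >> <<s events delta setT >> ;
  Z0_independent : forall nu0,
    independent (P nu0) <<s events Z [set 0%N] >>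
      <<s events eps setT `|` events delta setT >> ;
  S_law_past : forall nu0 n (t : R), 0 <= t ->
    is_cond_prob (P nu0) <<s events Z setT `|` events S `I_n.+1 >>
      [set w | (t%:E < S n.+1 w)%E]
      (fun w => (survival_censored lambda tstar (Z n w) t)%:E) ;
  S_law : forall nu0 n (t : R), 0 <= t ->
    is_cond_prob (P nu0) <<s events Z [set n] >>
      [set w | (t%:E < S n.+1 w)%E]
      (fun w => (survival_censored lambda tstar (Z n w) t)%:E)
}.

(** [lambda_measurable] is what gives a meaning to $\int_0^t\lambda(\xi,s)ds$.
    Time being a real number here, conditions are only required at times
    [0 <= t]. *)
Record jump_characteristics lambda tstar : Prop := {
  lambda_ge0 : forall xi t, 0 <= t -> 0 <= lambda xi t ;
  lambda_measurable : forall xi, measurable_fun (`[0, +oo[ : set R) (lambda xi) ;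
  tstar_gt0 : forall xi, (0 < tstar xi)%E ;
  lambda_lipschitz : exists2 L : R, 0 < L & forall xi xi' t, 0 <= t ->
    `|lambda xi t - lambda xi' t| <= L * mdist (point_of xi) (point_of xi') ;
  lambda_dominated : exists M : R -> R,
    [/\ forall t, 0 <= t -> 0 <= M t,
        forall t, 0 <= t ->
          lebesgue_measure.-integrable (`[0, t] : set R) (EFin \o M) &
        forall xi t, 0 <= t -> lambda xi t <= M t] ;
  density_continuous : forall xi,
    {within (`[0, +oo[ : set R), continuous (jump_density lambda xi)} ;
  density_bounded : exists C : R, forall xi t, 0 <= t ->
    `|jump_density lambda xi t| <= C ;
  tstar_continuous : continuous tstar
}.

Definition diffuse (Q : R.-pker (state e0) ~> (state e0)) : Prop :=
  forall xi xi' : state e0, Q xi [set xi'] = 0%E.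

Definition ergodic (P : probability (state e0) R -> probability Om R)
    (Z : nat -> Om -> state e0) (nu : probability (state e0) R) : Prop :=
  forall x : state e0,
    tv_dist (pushforward (P (\d_x : probability _ R)) (Z n)) nu
      @[n --> \oo] --> 0%E.

Definition smoothing_kernel (K : R -> R) : Prop :=
  [/\ continuous K,
      closure [set x | K x != 0] = `[-1, 1]%classic &
      (\int[lebesgue_measure]_x (K x)%:E = 1)%E].

(** $\mathcal B_\nu^+$; closures and the boundary are taken in the ambient
    space. *)
Definition Bplus (nu : probability (state e0) R) (A : set (state e0)) : Prop :=
  [/\ measurable A, precompact (point_of @` A), (0 < nu A)%E &
      closure (point_of @` A) `&` boundary E = set0].

Definition tstar_inf tstar (A : set (state e0)) : \bar R :=
  ereal_inf (tstar @` A).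

Definition limit_rate lambda (nu : probability (state e0) R)
    (A : set (state e0)) (t : R) : R :=
  (\int[nu]_(xi in A) jump_density lambda xi t) /
  (\int[nu]_(xi in A) survival lambda xi t).

End model.

(* Main.v *)
Require Import Defs.
From HB Require Import structures.
From mathcomp Require Import all_boot all_order all_algebra.
From mathcomp Require Import finmap all_classical all_reals all_analysis.
From mathcomp Require Import measurable_realfun.
From mathcomp Require Import zify ring lra.

Set Implicit Arguments.
Unset Strict Implicit.
Unset Printing Implicit Defensive.

Import Order.TTheory GRing.Theory Num.Theory.
Import numFieldNormedType.Exports.

Local Open Scope classical_set_scope.
Local Open Scope ring_scope.

(** Write q_n(tau) for the proportion of indices i < n such that Z_i lies in A and
    S_(i+1) > tau, y(tau) for the integral over A of the survival function
    G(z, tau) against nu, and F(tau) for the integral over A of the density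
    f(z, tau). Then y' = - F and the target is l = F / y.

    The estimator is governed by q_n. Cut ]0, t] into N bins. Between two grid
    points the at-risk count lies between n q_n at the two ends, and the number
    of jumps in a bin is n times the decrement of q_n. Hence, for a fixed
    bandwidth b, once q_n is close to y at the N + 1 grid points, the estimator
    is close, uniformly in u, to the smoothing of F / y by the rescaled kernel
    (rate_est_near_smoothed): K is uniformly continuous, so replacing a jump time
    by the end of its bin costs little. As b tends to 0 the smoothing of l tends
    to l uniformly on [r1, r2] (kernel_smoothing_cvg). So b is chosen first, then
    N, then the tolerance eta on the frequencies (rate_est_uniform).

    The frequencies converge in L2 under every P_x. Put h(z) = 1_A(z) G(z, tau).
    Given the whole chain, S_(i+1) depends on Z_i alone and is independent of the
    earlier interarrival times, so the events in which i and k = i + d are counted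
    have joint probability Q^i (h Q^d h) (x) (prob_surv_eventI_from). Total
    variation convergence from every starting point makes Q^d h tend pointwise to
    m = nu(h), hence this probability is close to m^2 when i and d are large, and
    the variance is a double Cesaro mean that vanishes
    (mean_centered_moment_cvg). Chebyshev then controls q_n at finitely many times.

    One bandwidth has to serve all starting points although the speed of
    convergence depends on x. It is read off the first state: Z_0 = x almost
    surely under P_x, so a diagonal extraction may depend on x through Z_0, as
    long as it is measurable in x (diagonal_selection). This is why the second
    moments are needed as explicit expressions in the kernel Q. Finally the
    error event is measurable because the error is continuous in u, which
    reduces the supremum to a countable grid (measurable_sup_itv). *)

(** * The kernel estimator as a finite sum *)

Section step_stieltjes.
Context {R : realType}.

(** A step distribution function puts mass [a i] at the point [p i]; points at
    infinity carry no mass. The Stieltjes measure is identified with the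
    corresponding sum of Dirac masses through its values on half-open intervals,
    and positive and negative parts of [g] are integrated separately. *)
Lemma Rintegral_step (F : cumulative R R) n (a : nat -> R) (p : nat -> \bar R)
    (D : set R) (g : R -> R) :
  (forall i, 0 <= a i) ->
  (forall x y, x <= y ->
     F y - F x = \sum_(i < n) a i * (x%:E < p i <= y%:E)%E%:R) ->
  measurable D -> measurable_fun D g ->
  \int[lebesgue_stieltjes_measure F]_(v in D) g v =
    \sum_(i < n) a i * ((p i \is a fin_num) && (fine (p i) \in D))%:R
      * g (fine (p i)).
Proof.
move=> a0 FE mD mg.
have c0 i : 0 <= a i * (p i \is a fin_num)%:R by rewrite mulr_ge0.
pose m_ i : {measure set (measurableTypeR R) -> \bar R} :=
  mscale (NngNum (c0 i)) (@dirac _ (measurableTypeR R) (fine (p i)) R).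
have mE B : measurable B ->
    lebesgue_stieltjes_measure F B = msum m_ n B.
  apply: lebesgue_stieltjes_measure_unique => _ [[x y] _ <-] /=.
  have [xy|yx] := leP x y; last first.
    by rewrite set_itv_ge ?measure0// bnd_simp -leNgt ltW.
  rewrite /lebesgue_stieltjes_measure /measure_extension/=.
  rewrite measurable_mu_extE/= ?wlength_itv_bnd//; last exact: is_ocitv.
  rewrite FE// -sumEFin /msum; apply: eq_bigr => i _.
  rewrite /m_ /mscale/= /mscale/= diracE -EFinM -mulrA -natrM mulnb; congr (_ * _%:R)%:E.
  congr nat_of_bool; rewrite mem_setE in_itv/=.
  by case: (p i) => [r| |]//=; rewrite ?lte_fin ?lee_fin ?andbF// leNgt ltNyr.
have intE (h : R -> \bar R) : (forall x, D x -> 0 <= h x)%E ->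
    measurable_fun D h -> (forall x, h x \is a fin_num) ->
    (\int[lebesgue_stieltjes_measure F]_(v in D) h v =
    (\sum_(i < n) a i * ((p i \is a fin_num) && (fine (p i) \in D))%:R
      * fine (h (fine (p i))))%:E)%E.
  move=> h0 mh hfin; rewrite (eq_measure_integral (msum m_ n)); last first.
    by move=> B mB _; exact: mE.
  rewrite ge0_integral_measure_sum// -sumEFin; apply: eq_bigr => i _.
  rewrite ge0_integral_mscale// integral_dirac//= diracE.
  by rewrite -[in LHS](fineK (hfin _)) -!EFinM -mulnb natrM !mulrA.
rewrite /Rintegral integralE !intE//=; last 4 first.
- exact/measurable_funeneg/measurable_EFinP.
- by move=> x; rewrite funenegE -EFinN -EFin_max.
- exact/measurable_funepos/measurable_EFinP.
- by move=> x; rewrite funeposE -EFin_max.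
rewrite -sumrB; apply: eq_bigr => i _; rewrite -mulrBr; congr (_ * _).
rewrite funeposE funenegE -EFinN -!EFin_max/=.
by rewrite /Num.max; case: ifPn; case: ifPn; lra.
Qed.

End step_stieltjes.
Section estimator_formula.
Context {R : realType} {T : Type}.
Variables (A : set T) (z : nat -> T) (s : nat -> \bar R) (n : nat).

(** Jump times are extended reals while the estimator integrates over the real
    line; this merges the finiteness test and the membership test. *)
Lemma in_ocitv_fin (p : \bar R) (x y : R) :
  (p \is a fin_num) && (fine p \in `]x, y]%classic) = (x%:E < p <= y%:E)%E.
Proof.
rewrite mem_setE in_itv/=; case: p => [r| |] //=.
by rewrite leye_eq andbF.
Qed.

Lemma EFin_itvoc_lt_le (x y : R) (p : \bar R) : x <= y ->
  (x%:E < p <= y%:E)%E%:R = (p <= y%:E)%E%:R - (p <= x%:E)%E%:R :> R.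
Proof.
move=> xy; have [px|xp] := leP p x%:E.
  by rewrite (le_trans px)/= ?lee_fin// subrr.
by rewrite subr0.
Qed.

Lemma cum_rate_estE x : cum_rate_est A z s n x =
  \sum_(i < n) \1_A (z i) * (0 < s i.+1 <= x%:E)%E%:R
    * at_risk_inv A z s n (fine (s i.+1)).
Proof.
rewrite /cum_rate_est.
rewrite (@Rintegral_step _ _ n (fun i => \1_A (z i)) (fun i => s i.+1))//.
- by apply: eq_bigr => i _; rewrite in_ocitv_fin.
- move=> v w vw; rewrite /= /jump_count -sumrB; apply: eq_bigr => i _.
  by rewrite EFin_itvoc_lt_le// mulrBr !(mulrC (\1_A _)).
- apply: measurable_funTS; exact: measurable_at_risk_inv.
Qed.

(** [cum_rate_est] is itself a step function, with jumps of size
    [at_risk_inv] at the jump times, so [Rintegral_step] applies twice. *)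
Lemma rate_estE (K : R -> R) (b t u : R) : measurable_fun setT K ->
  rate_est A z s n K b t u = b^-1 * \sum_(i < n)
    \1_A (z i) * (0 < s i.+1 <= t%:E)%E%:R
      * at_risk_inv A z s n (fine (s i.+1)) * K ((u - fine (s i.+1)) / b).
Proof.
move=> mK; rewrite /rate_est; congr (_ * _).
rewrite (@Rintegral_step _ _ n (fun i => \1_A (z i) * (0 < s i.+1)%E%:R
    * at_risk_inv A z s n (fine (s i.+1))) (fun i => s i.+1))//.
- apply: eq_bigr => i _; rewrite in_ocitv_fin; congr (_ * _).
  by case: (0 < s i.+1)%E => /=; rewrite ?(mulr0, mul0r, mulr1)// mulrAC.
- by move=> i; rewrite !mulr_ge0// ?at_risk_inv_ge0// indicE.
- move=> v w vw; rewrite /= !cum_rate_estE -sumrB; apply: eq_bigr => i _.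
  rewrite (EFin_itvoc_lt_le _ vw); case: (0 < s i.+1)%E => /=.
    by rewrite mulr1 -mulrBl -mulrBr mulrAC.
  by rewrite !(mulr0, mul0r) subrr.
- apply: measurable_funTS; apply: measurableT_comp => //.
  by apply: measurable_funM => //; exact: measurable_funB.
Qed.

End estimator_formula.

(** * Kernel smoothing *)

Section uniform_continuity.
Context {R : realType}.
Implicit Types f : R -> R.

(** Heine's theorem in a form where only one of the two points has to lie in the
    interval, which spares end point distinctions. *)
Lemma continuous_itv_uniform f (a b : R) : continuous f ->
  forall e : R, 0 < e -> exists2 d : R, 0 < d &
    forall x y : R, x \in `[a, b] -> `|x - y| <= d -> `|f x - f y| <= e.
Proof.
move=> cf e e0.
have /compact_near_coveringP := @segment_compact R a b.
move=> /(_ R (0 : R)^'+ (fun d x => forall y, `|x - y| <= d -> `|f x - f y| <= e)).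
have cov : forall x : R, `[a, b]%classic x -> \forall x' \near x & d \near (0 : R)^'+,
    forall y, `|x' - y| <= d -> `|f x' - f y| <= e.
  move=> x _.
  have e2 : 0 < e / 2 by rewrite divr_gt0.
  have /cvgrPdist_le/(_ _ e2) := cf x.
  move=> /nbhs_ballP[r /= r0 xr].
  have r2 : 0 < r / 2 by rewrite divr_gt0.
  exists (ball x (r / 2), [set d | d < r / 2]).
    split; [exact: nbhsx_ballx|exact: nbhs_right_lt].
  move=> [x' d] [/= xx' dr] y yd.
  have H1 : `|f x - f x'| <= e / 2.
    by apply: xr => /=; apply: lt_trans xx' _; lra.
  have H2 : `|f x - f y| <= e / 2.
    apply: xr => /=; rewrite /ball/= in xx' *.
    rewrite (le_lt_trans (ler_distD x' _ _))//; lra.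
  rewrite (le_trans (ler_distD (f x) _ _))// (distrC (f x')); lra.
move=> /(_ _ cov) H.
near (0 : R)^'+ => d.
exists d => // x y xab; move: y; have : `[a, b]%classic x by [].
by move: x {xab}; near: d.
Unshelve. all: by end_near. Qed.

Lemma continuous_integrable_itvoc f (a b : R) : continuous f ->
  lebesgue_measure.-integrable `]a, b] (EFin \o f).
Proof.
move=> cf; have : lebesgue_measure.-integrable `[a, b] (EFin \o f).
  apply: continuous_compact_integrable; first exact: segment_compact.
  exact: continuous_subspaceT.
by apply: integrableS => //; exact: subset_itv_oc_cc.
Qed.

End uniform_continuity.

Section smoothing.
Context {R : realType}.
Variable K : R -> R.
Hypothesis hK : smoothing_kernel K.

Let cK : continuous K. Proof. by case: hK. Qed.

Lemma smoothing_kernel_eq0 x : 1 < `|x| -> K x = 0.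
Proof.
case: hK => _ K1 _ x1; apply/eqP/negPn/negP => Kx.
have : closure [set x | K x != 0] x by exact: subset_closure.
by rewrite K1/= in_itv/= -ler_norml leNgt x1.
Qed.

Lemma smoothing_kernel_bounded : exists2 k : R, 0 < k & forall x, `|K x| <= k.
Proof.
have cabs : {within `[-1, 1], continuous (fun x => `|K x|)}.
  apply: continuous_subspaceT => x; apply: continuous_comp; first exact: cK.
  exact: norm_continuous.
have m11 : (-1 : R) <= 1 by lra.
have [c _ cmax] := EVT_max m11 cabs.
exists (`|K c| + 1); first by rewrite ltr_wpDl.
move=> x; have [x1|x1] := leP `|x| 1.
  have /cmax/le_trans -> // : x \in `[-1, 1] by rewrite in_itv/= -ler_norml.
  by rewrite lerDl.
by rewrite smoothing_kernel_eq0// normr0 addr_ge0.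
Qed.

(** Outside [-2, 2] two points at distance at most 1/2 are both out of the
    support, so uniform continuity near the support is enough. *)
Lemma smoothing_kernel_uniform (e : R) : 0 < e ->
  exists2 d : R, 0 < d & forall x y : R, `|x - y| <= d -> `|K x - K y| <= e.
Proof.
move=> e0; have [d d0 dK] := @continuous_itv_uniform _ K (-2) 2 cK _ e0.
exists (Num.min d (1/2)); first by rewrite lt_min d0 divr_gt0.
move=> x y; rewrite le_min => /andP[xyd xy1].
have [x2|x2] := leP `|x| 2; first by apply: dK => //; rewrite in_itv/= -ler_norml.
rewrite !smoothing_kernel_eq0 ?subrr ?normr0 ?(ltW e0)//; last by lra.
have := ler_distD y x 0; rewrite !subr0; lra.
Qed.

Lemma continuous_scaled_kernel (u b : R) : continuous (fun v => K ((u - v) / b)).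
Proof.
move=> v; apply: continuous_comp; last exact: cK.
apply: cvgM; last exact: cvg_cst.
by apply: cvgB; [exact: cvg_cst|exact: cvg_id].
Qed.

(** The bounds on [u] place the support of the rescaled kernel inside [0, t], so
    nothing of the unit mass of [K] is lost. *)
Lemma integral_scaled_smoothing_kernel (t u b : R) : 0 < b -> b <= u -> u <= t - b ->
  \int[lebesgue_measure]_(v in `]0, t]) (K ((u - v) / b) / b) = 1.
Proof.
move=> b0 bu ut; pose g v := (u - v) / b.
have t0 : 0 <= t by lra.
rewrite Rintegral_itv_obnd_cbnd; last first.
  apply: continuous_integrable_itvoc => v.
  by apply: cvgM; [exact: continuous_scaled_kernel|exact: cvg_cst].
have dg (x : R) : is_derive x (1 : R) g (- b^-1).
  rewrite /g; apply: is_derive_eq.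
  by rewrite /GRing.scale/=; ring.
have g'E : derive1 g = cst (- b^-1).
  by apply/funext => x; rewrite derive1E; exact: derive_val.
have cg : continuous g.
  by move=> x; apply/differentiable_continuous/derivable1_diffP; apply: ex_derive.
have := @integration_by_substitution_decreasing R g K 0 t t0.
rewrite g'E /Rintegral => H.
rewrite (_ : (fun x => _) = fun x => (((K \o g) * - cst (- b^-1)) x)%:E); last first.
  by apply/funext => x; rewrite /= fctE/= opprK.
rewrite -H//.
- rewrite (_ : (\int[_]_(x in _) _)%E = 1%E)//.
  case: hK => _ _ <-; rewrite integral_mkcond; apply: eq_integral => x _.
  rewrite patchE; case: ifPn => // xI; rewrite smoothing_kernel_eq0//.
  rewrite ltNge; apply: contra xI => x1; rewrite inE/= in_itv/= /g.
  move: x1; rewrite ler_norml => /andP[x1 x2].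
  rewrite subr0 ler_pdivrMr// ler_pdivlMr//.
  by apply/andP; split; nra.
- by move=> x y _ _ xy; rewrite /g ltr_pM2r ?invr_gt0//; lra.
- by move=> x _; exact: cst_continuous.
- exact: is_cvg_cst.
- exact: is_cvg_cst.
- split; first by move=> x _; exact: ex_derive.
  + by apply: cvg_at_right_filter; exact: cg.
  + by apply: cvg_at_left_filter; exact: cg.
- exact: continuous_subspaceT.
Qed.

(** Since the rescaled kernel has integral one, the difference is the integral of
    the kernel against [l v - l u], which only sees points at distance at most
    [b] from [u]: the bound is the oscillation of [l] times [2 k]. *)
Lemma kernel_smoothing_cvg (l : R -> R) (r1 r2 t : R) : continuous l ->
  0 < r1 -> r2 < t ->
  forall e : R, 0 < e -> exists2 b0 : R, 0 < b0 & forall b : R, 0 < b -> b <= b0 ->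
    forall u : R, u \in `[r1, r2] ->
    `|b^-1 * \int[lebesgue_measure]_(v in `]0, t]) (K ((u - v) / b) * l v) - l u| <= e.
Proof.
move=> cl r10 r2t e e0; have [k k0 Kk] := smoothing_kernel_bounded.
have e'0 : 0 < e / (2 * k) by rewrite divr_gt0// mulr_gt0.
have [d d0 dl] := continuous_itv_uniform r1 r2 cl e'0.
(* The last two bounds keep the rescaled support inside [0, t]. *)
exists (Num.min d (Num.min r1 (t - r2))).
  by rewrite !lt_min d0 r10/=; lra.
move=> b b0; rewrite !le_min => /and3P[bd br1 btr2] u ur.
have [ur1 ur2] : r1 <= u /\ u <= r2 by move: ur; rewrite in_itv => /andP[].
have cKs := @continuous_scaled_kernel u b.
have cc (g : R -> R) : continuous g -> continuous (fun v => K ((u - v) / b) / b * g v).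
  by move=> cg v; apply: cvgM; [apply: cvgM; [exact: cKs|exact: cvg_cst]|exact: cg].
have -> : l u = \int[lebesgue_measure]_(v in `]0, t]) (K ((u - v) / b) / b * l u).
  rewrite RintegralZr//; last first.
    apply: continuous_integrable_itvoc => v; apply: cvgM; first exact: cKs.
    exact: cvg_cst.
  by rewrite integral_scaled_smoothing_kernel ?mul1r//; lra.
rewrite -RintegralZl//; last first.
  apply: continuous_integrable_itvoc => v; apply: cvgM; first exact: cKs.
  exact: cl.
rewrite -RintegralB//; first last.
- by apply: continuous_integrable_itvoc; apply: cc => v; exact: cvg_cst.
- apply: continuous_integrable_itvoc => v; apply: cvgM; first exact: cvg_cst.
  by apply: cvgM; [exact: cKs|exact: cl].
have int1 : lebesgue_measure.-integrable `]0, t] (EFin \o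
    (fun x => b^-1 * (K ((u - x) / b) * l x) - K ((u - x) / b) / b * l u)).
  apply: continuous_integrable_itvoc => v; apply: cvgB.
    by apply: cvgM; [exact: cvg_cst|apply: cvgM; [exact: cKs|exact: cl]].
  by apply: cc => w; exact: cvg_cst.
apply: le_trans (le_normr_Rintegral _ int1) _ => //.
have indI : lebesgue_measure.-integrable `]0, t] (EFin \o \1_(`[u - b, u + b])).
  exact: integrableS (integrable_indic_itv (u - b) (u + b) true false).
have int2 : lebesgue_measure.-integrable `]0, t]
    (EFin \o (fun x => e / (2 * b) * \1_(`[u - b, u + b]) x)).
  have -> : EFin \o (fun x => e / (2 * b) * \1_(`[u - b, u + b]) x) =
      (fun x : R => (e / (2 * b))%:E * (\1_(`[u - b, u + b]) x)%:E)%E by [].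
  exact: integrableZl.
apply: (@le_trans _ _ (\int[lebesgue_measure]_(v in `]0, t])
    (e / (2 * b) * \1_(`[u - b, u + b]) v))).
  apply: le_Rintegral => //.
    exact: integrable_norm int1.
  move=> v; rewrite /= in_itv/= => /andP[v0 vt].
  have [vb|vb] := leP `|u - v| b.
    rewrite indicE mem_set ?mulr1/=; last first.
      by move: vb; rewrite in_itv/= ler_norml; lra.
    rewrite (_ : _ - _ = K ((u - v) / b) * b^-1 * (l v - l u)); last by ring.
    rewrite !normrM normfV (gtr0_norm b0).
    rewrite (_ : e / (2 * b) = k * b^-1 * (e / (2 * k))); last by field; lra.
    apply: ler_pM => //; first by rewrite mulr_ge0// invr_ge0 ltW.
    - by apply: ler_pM => //; rewrite invr_ge0 ltW.
    - by rewrite distrC; apply: dl => //; exact: le_trans vb bd.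
  rewrite smoothing_kernel_eq0 ?(mul0r, mulr0) ?subrr ?normr0.
    by rewrite !mulr_ge0 ?invr_ge0// ?mulr_ge0// ltW.
  by rewrite normrM normfV (gtr0_norm b0) ltr_pdivlMr// mul1r.
rewrite RintegralZl//.
rewrite /Rintegral integral_indic//.
have : (lebesgue_measure (`[(u - b)%R, (u + b)%R]%classic `&` `]0%R, t]%classic) <= (2 * b)%:E)%E.
  apply: (@le_trans _ _ (lebesgue_measure `[(u - b)%R, (u + b)%R]%classic)).
    by apply: le_measure; rewrite ?inE//; exact: measurableI.
  by rewrite lebesgue_measure_itv/= lte_fin; case: ifPn => _; rewrite lee_fin; lra.
move=> mb; rewrite (@le_trans _ _ (e / (2 * b) * (2 * b)))//.
  rewrite ler_pM2l ?divr_gt0 ?mulr_gt0//.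
  rewrite -lee_fin fineK// ge0_fin_numE//; exact: le_lt_trans mb (ltry _).
by rewrite divfK// gt_eqF// mulr_gt0.
Qed.

End smoothing.

(** * From survivor frequencies to the estimator *)

Section survivors.
Context {R : realType} {T : Type}.
Variables (A : set T) (z : nat -> T) (s : nat -> \bar R) (n : nat).

(** Strict inequalities make decrements of this function count the jumps in
    half-open intervals, and sandwich the at-risk count, which is defined with a
    large inequality. *)
Definition surv_count (x : R) : R :=
  \sum_(i < n) \1_A (z i) * (x%:E < s i.+1)%E%:R.

Definition surv_freq (x : R) : R := n%:R^-1 * surv_count x.

Lemma surv_count_at_risk (x p x' : R) : x < p -> p <= x' ->
  surv_count x' <= at_risk A z s n p <= surv_count x.
Proof.
move=> xp px'; apply/andP; split; apply: ler_sum => i _.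
  rewrite mulrC ler_wpM2r ?indicE// ler_nat.
  have [xs|//] := boolP (x'%:E < s i.+1)%E.
  by rewrite (le_trans _ (ltW xs))// lee_fin.
rewrite mulrC ler_wpM2l ?indicE// ler_nat.
have [ps|//] := boolP (p%:E <= s i.+1)%E.
by rewrite (lt_le_trans _ ps)// lte_fin.
Qed.

Lemma surv_countB (x x' : R) : x <= x' ->
  surv_count x - surv_count x' =
  \sum_(i < n) \1_A (z i) * (x%:E < s i.+1 <= x'%:E)%E%:R.
Proof.
move=> xx'; rewrite -sumrB; apply: eq_bigr => i _; rewrite -mulrBr; congr (_ * _).
rewrite EFin_itvoc_lt_le//; case: leP => _; case: leP => _ /=; lra.
Qed.

Lemma surv_freq_ge0 x : 0 <= surv_freq x.
Proof.
rewrite mulr_ge0// ?invr_ge0//; apply: sumr_ge0 => i _.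
by rewrite mulr_ge0// indicE.
Qed.

Lemma surv_freq_le1 x : surv_freq x <= 1.
Proof.
rewrite /surv_freq; have [->|n0] := eqVneq n 0; first by rewrite invr0 mul0r.
rewrite ler_pdivrMl ?ltr0n ?lt0n// mulr1 /surv_count.
rewrite -[leRHS](_ : \sum_(i < n) 1 = _); last first.
  by rewrite sumr_const card_ord.
apply: ler_sum => i _; rewrite indicE -natrM; case: (_ \in A) => //=.
by rewrite mul1n; case: ltP.
Qed.

End survivors.

Section quotient.
Context {R : realFieldType}.

Lemma ler_dist_div (k m d w a a' c c' : R) : 0 < m -> m / 2 <= a -> m <= a' ->
  `|c| <= k -> `|c - c'| <= w -> `|a - a'| <= d ->
  `|c / a - c' / a'| <= 2 * k * d / m ^+ 2 + w / m.
Proof.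
move=> m0 ma ma' ck cw ad.
have a0 : 0 < a by lra.
have a'0 : 0 < a' by lra.
have -> : c / a - c' / a' = c * ((a' - a) / (a * a')) + (c - c') / a'.
  by field; rewrite !gt_eqF.
apply: (le_trans (ler_normD _ _)); apply: lerD; last first.
  rewrite normrM normfV (gtr0_norm a'0); apply: ler_pM => //.
    by rewrite invr_ge0 ltW.
  by rewrite lef_pV2 ?posrE.
have -> : 2 * k * d / m ^+ 2 = k * (d * (m / 2 * m)^-1).
  by field; rewrite gt_eqF.
rewrite normrM; apply: ler_pM => //.
rewrite normrM distrC; apply: ler_pM => //.
rewrite gtr0_norm ?invr_gt0 ?mulr_gt0//.
rewrite lef_pV2 ?posrE ?mulr_gt0//; apply: ler_pM => //; lra.
Qed.

End quotient.

Section deterministic.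
Context {R : realType} {T : Type}.
Variables (A : set T) (F y K : R -> R).
Hypotheses (cF : continuous F) (cy : continuous y) (F_ge0 : forall x, 0 <= F x)
  (y_gt0 : forall x, 0 < y x) (y0_le1 : y 0 <= 1).
Hypothesis yF : forall a b, 0 <= a -> a <= b ->
  \int[lebesgue_measure]_(v in `]a, b]) F v = y a - y b.
Hypothesis hK : smoothing_kernel K.

Let y_ni (a b : R) : 0 <= a -> a <= b -> y b <= y a.
Proof.
by move=> a0 ab; rewrite -subr_ge0 -yF// Rintegral_ge0.
Qed.

Let cK : continuous K. Proof. by case: hK. Qed.

Let cpsi (u b : R) : continuous (fun v => K ((u - v) / b) / y v * F v).
Proof.
move=> v; apply: cvgM; last exact: cF.
apply: cvgM; first exact: (continuous_scaled_kernel hK).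
by apply: cvgV; [rewrite gt_eqF|exact: cy].
Qed.

Let bin_integral (u b x x' c e : R) : 0 <= x -> x <= x' ->
  (forall v, x < v -> v <= x' -> `|K ((u - v) / b) / y v - c| <= e) ->
  `|\int[lebesgue_measure]_(v in `]x, x']) (K ((u - v) / b) / y v * F v) -
    c * (y x - y x')| <= e * (y x - y x').
Proof.
move=> x0 xx' ce; rewrite -yF//.
have iF := @continuous_integrable_itvoc R F x x' cF.
have ipsi := continuous_integrable_itvoc x x' (@cpsi u b).
have icF : lebesgue_measure.-integrable `]x, x'] (EFin \o (fun v => c * F v)).
  by apply: continuous_integrable_itvoc => v; apply: cvgM; [exact: cvg_cst|exact: cF].
have ieF : lebesgue_measure.-integrable `]x, x'] (EFin \o (fun v => e * F v)).
  by apply: continuous_integrable_itvoc => v; apply: cvgM; [exact: cvg_cst|exact: cF].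
rewrite -!RintegralZl// -RintegralB//.
have idiff : lebesgue_measure.-integrable `]x, x']
    (EFin \o (fun v => K ((u - v) / b) / y v * F v - c * F v)).
  apply: continuous_integrable_itvoc => v; apply: cvgB; first exact: cpsi.
  by apply: cvgM; [exact: cvg_cst|exact: cF].
apply: le_trans (le_normr_Rintegral _ idiff) _ => //.
apply: le_Rintegral => //; first exact: integrable_norm idiff.
move=> v; rewrite /= in_itv/= => /andP[xv vx'].
by rewrite -mulrBl normrM (ger0_norm (F_ge0 v)) ler_wpM2r// ce.
Qed.

(** In each bin the summand of the estimator and the integrand of the smoothed
    rate are both replaced by the same constant, the value at the right end of
    the bin. What remains is the difference between the mass of the bin for
    the empirical and for the limit survival function. The number [N] of bins is
    chosen before the tolerance [eta], because the latter errors add up over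
    the bins. *)
Lemma rate_est_near_smoothed (t b e : R) : 0 < t -> 0 < b -> 0 < e ->
  exists N : nat, exists eta : R, [/\ (0 < N)%N, 0 < eta &
    forall z (s : nat -> \bar R) n,
    (forall j, (j <= N)%N ->
       `|surv_freq A z s n (j%:R * t / N%:R) - y (j%:R * t / N%:R)| <= eta) ->
    forall u, `|rate_est A z s n K b t u -
      b^-1 * \int[lebesgue_measure]_(v in `]0, t]) (K ((u - v) / b) * (F v / y v))|
      <= e].
Proof.
move=> t0 b0 e0; have [k k0 Kk] := smoothing_kernel_bounded hK.
pose m := y t; have m0 : 0 < m := y_gt0 t.
(* [w] bounds the oscillation of [y] over a bin and [wK] that of the kernel;
they are tuned so that the per-bin error of [ler_dist_div] is [e * b / 4]. *)
pose w := e * b * m ^+ 2 / (32 * k).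
have w0 : 0 < w by rewrite /w divr_gt0 ?mulr_gt0 ?exprn_gt0.
pose wK := e * b * m / 8.
have wK0 : 0 < wK by rewrite /wK !mulr_gt0.
have [dy dy0 dyP] := continuous_itv_uniform 0 t cy w0.
have [dK dK0 dKP] := smoothing_kernel_uniform hK wK0.
pose d := Num.min dy (dK * b).
have d0 : 0 < d by rewrite lt_min dy0 mulr_gt0.
pose N := (Num.truncn (t / d)).+1.
have N0 : 0 < N%:R :> R by rewrite ltr0n.
have tNd : t / N%:R <= d.
  rewrite ler_pdivrMr// mulrC -ler_pdivrMr//.
  by apply/ltW/truncnS_gt.
pose eta := Num.min w (Num.min (m / 2) (e * b * m / (4 * N%:R * k))).
have eta0 : 0 < eta.
  by rewrite /eta !lt_min w0 !divr_gt0 ?mulr_gt0.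
have [etaw etam etaN] : [/\ eta <= w, eta <= m / 2 & eta * N%:R * (2 * k / m) <= e * b / 2].
  split; rewrite /eta ?ge_min ?lexx ?orbT//.
  rewrite (_ : e * b / 2 = e * b * m / (4 * N%:R * k) * (N%:R * (2 * k / m))).
    rewrite -mulrA ler_wpM2r//; first by rewrite !mulr_ge0 ?invr_ge0 ?ltW.
    by rewrite !ge_min lexx !orbT.
  by field; rewrite !gt_eqF.
exists N; exists eta; split => // z s n qy u.
pose tj j : R := j%:R * t / N%:R.
have tj0 : tj 0%N = 0 by rewrite /tj !mul0r.
have tjN : tj N = t by rewrite /tj mulrAC divff ?mul1r// gt_eqF.
have tjS j : tj j.+1 = tj j + t / N%:R by rewrite /tj -natr1; ring.
have tN0 : 0 < t / N%:R by rewrite divr_gt0.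
have tjle j : tj j <= tj j.+1 by rewrite tjS lerDl ltW.
have tjge0 j : 0 <= tj j by rewrite /tj !mulr_ge0 ?invr_ge0// ltW.
have tjt j : (j <= N)%N -> tj j <= t.
  by move=> jN; rewrite -[leRHS]tjN /tj !ler_wpM2r ?invr_ge0 ?ler_nat// ltW.
have ym x : 0 <= x -> x <= t -> m <= y x by exact: y_ni.
pose q := surv_freq A z s n.
pose c j := K ((u - tj j) / b) / y (tj j).
have close_K p j : tj j < p -> p <= tj j.+1 ->
    `|K ((u - p) / b) - K ((u - tj j.+1) / b)| <= wK.
  move=> p1 p2; apply: dKP; rewrite -mulrBl normrM normfV (gtr0_norm b0).
  rewrite ler_pdivrMr// (le_trans _ (_ : d <= _)) ?ge_min ?lexx ?orbT//.
  rewrite (le_trans _ tNd)// ler_norml; move: p1 p2; rewrite tjS; lra.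
have close_y p j : (j < N)%N -> tj j <= p -> p <= tj j.+1 ->
    `|y p - y (tj j.+1)| <= w.
  move=> jN p1 p2; have tjp := tjge0 j; have tjt' := tjt _ jN.
  apply: dyP; first by rewrite in_itv/=; lra.
  rewrite (le_trans _ (_ : d <= _)) ?ge_min ?lexx//.
  rewrite (le_trans _ tNd)// ler_norml; move: p1 p2; rewrite tjS; lra.
have e1E : 2 * k * (2 * w) / m ^+ 2 + wK / m = e * b / 4.
  by rewrite /w /wK; field; rewrite !gt_eqF.
have close_int j v : (j < N)%N -> tj j < v -> v <= tj j.+1 ->
    `|K ((u - v) / b) / y v - c j.+1| <= e * b / 4.
  move=> jN v1 v2; have tjp := tjge0 j; have tjt' := tjt _ jN.
  rewrite -e1E; apply: ler_dist_div => //.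
  - have : m <= y v by apply: ym; lra.
    lra.
  - by apply: ym.
  - exact: close_K.
  - by rewrite (le_trans (close_y v j jN (ltW v1) v2))//; lra.
have close_sum j p : (0 < n)%N -> (j < N)%N -> tj j < p -> p <= tj j.+1 ->
    `|n%:R * at_risk_inv A z s n p * K ((u - p) / b) - c j.+1| <= e * b / 4.
  move=> n0 jN p1 p2; have tjp := tjge0 j; have tjt' := tjt _ jN.
  have n0' : 0 < n%:R :> R by rewrite ltr0n.
  pose Y := n%:R^-1 * at_risk A z s n p.
  have [Y1 Y2] : q (tj j.+1) <= Y /\ Y <= q (tj j).
    have /andP[Y1 Y2] := surv_count_at_risk A z s n p1 p2.
    by rewrite /q /surv_freq /Y !ler_pM2l ?invr_gt0.
  have := qy _ jN; rewrite -/(tj _) -/q ler_norml => /andP[q1 q2].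
  have := qy _ (ltnW jN); rewrite -/(tj _) -/q ler_norml => /andP[q3 q4].
  have := close_y _ _ jN (lexx _) (tjle j); rewrite ler_norml => /andP[y1 y2].
  have my : m <= y (tj j.+1) by apply: ym.
  have Ym : m / 2 <= Y by lra.
  have Y0 : 0 < at_risk A z s n p.
    by move: Ym; rewrite /Y ler_pdivlMl// => /(lt_le_trans _); apply; rewrite mulr_gt0// divr_gt0.
  rewrite /at_risk_inv gt_eqF//= -e1E.
  rewrite (_ : n%:R * _ = Y^-1); last by rewrite /Y invfM invrK.
  rewrite mulrC; apply: ler_dist_div => //; first exact: close_K.
  by rewrite ler_norml; lra.
pose Sm (x : R) := n%:R^-1 * \sum_(i < n) \1_A (z i) * (0 < s i.+1 <= x%:E)%E%:R
      * (n%:R * at_risk_inv A z s n (fine (s i.+1)) * K ((u - fine (s i.+1)) / b)).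
pose B (x : R) := \int[lebesgue_measure]_(v in `]0, x]) (K ((u - v) / b) / y v * F v).
have -> : rate_est A z s n K b t u = b^-1 * Sm t.
  rewrite rate_estE; last exact: continuous_measurable_fun.
  rewrite /Sm; congr (_ * _); rewrite mulr_sumr; apply: eq_bigr => i _.
  have n0 : n%:R != 0 :> R by rewrite pnatr_eq0; case: (n) i => // -[].
  by field.
have -> : \int[lebesgue_measure]_(v in `]0, t]) (K ((u - v) / b) * (F v / y v)) = B t.
  by apply: eq_Rintegral => v _; rewrite mulrAC mulrA.
have SmB : `|Sm t - B t| <= e * b.
  have Sm0 : Sm 0 = 0.
    rewrite /Sm big1 ?mulr0// => i _.
    by have [s0|//] := ltP 0%E (s i.+1); rewrite /= mulr0 mul0r.
  have B0 : B 0 = 0 by rewrite /B set_itvoc0 Rintegral_set0.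
  have dB j : B (tj j.+1) - B (tj j) = \int[lebesgue_measure]_(v in `]tj j, tj j.+1])
      (K ((u - v) / b) / y v * F v).
    rewrite /B Rintegral_itvB// ?bnd_simp//.
    exact: (continuous_integrable_itvoc _ _ (@cpsi u b)).
  have dSm j : Sm (tj j.+1) - Sm (tj j) = n%:R^-1 * \sum_(i < n)
      \1_A (z i) * ((tj j)%:E < s i.+1 <= (tj j.+1)%:E)%E%:R
      * (n%:R * at_risk_inv A z s n (fine (s i.+1)) * K ((u - fine (s i.+1)) / b)).
    rewrite -mulrBr -sumrB; congr (_ * _); apply: eq_bigr => i _.
    rewrite -mulrBl -mulrBr; congr (_ * _ * _).
    rewrite (EFin_itvoc_lt_le (s i.+1) (tjle j)).
    have [s0|s0] := ltP 0%E (s i.+1) => //=.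
    by rewrite !(le_trans s0) ?lee_fin ?subrr.
  have main j : (j < N)%N ->
      `|(Sm (tj j.+1) - B (tj j.+1)) - (Sm (tj j) - B (tj j))| <=
      e * b / 4 * (q (tj j) - q (tj j.+1)) + (k / m) * (2 * eta)
      + e * b / 4 * (y (tj j) - y (tj j.+1)).
    move=> jN.
    have H1 := bin_integral (tjge0 j) (tjle j) (fun v => close_int j v jN).
    have dq : q (tj j) - q (tj j.+1) = n%:R^-1 * \sum_(i < n)
        \1_A (z i) * ((tj j)%:E < s i.+1 <= (tj j.+1)%:E)%E%:R.
      by rewrite -mulrBr surv_countB.
    have H2 : `|Sm (tj j.+1) - Sm (tj j) - c j.+1 * (q (tj j) - q (tj j.+1))| <=
        e * b / 4 * (q (tj j) - q (tj j.+1)).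
      rewrite dSm dq mulrCA -mulrBr (mulrCA (e * b / 4)) normrM ger0_norm ?invr_ge0//.
      rewrite ler_wpM2l ?invr_ge0// !mulr_sumr -sumrB.
      apply: (le_trans (ler_norm_sum _ _ _)); apply: ler_sum => i _.
      rewrite (mulrC (c _)) -mulrBr normrM (mulrC (e * b / 4)).
      have a0 : 0 <= \1_A (z i) * ((tj j)%:E < s i.+1 <= (tj j.+1)%:E)%E%:R :> R.
        by rewrite mulr_ge0// indicE.
      rewrite ger0_norm//.
      have [si|si] := boolP ((tj j)%:E < s i.+1 <= (tj j.+1)%:E)%E; last first.
        by rewrite mulr0 !mul0r.
      rewrite ler_wpM2l ?mulr1 ?indicE//.
      have n0 : (0 < n)%N := leq_ltn_trans (leq0n i) (ltn_ord i).
      move: si; case: (s i.+1) => [p| |] /=; rewrite ?leye_eq ?andbF ?ltNge ?leNye//.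
      by rewrite -ltNge lte_fin lee_fin => /andP[p1 p2]; exact: close_sum.
    have H3 : `|c j.+1 * (q (tj j) - q (tj j.+1)) - c j.+1 * (y (tj j) - y (tj j.+1))|
        <= (k / m) * (2 * eta).
      rewrite -mulrBr normrM; apply: ler_pM => //.
        rewrite /c normrM normfV (gtr0_norm (y_gt0 _)); apply: ler_pM => //.
          by rewrite invr_ge0 ltW.
        by rewrite lef_pV2 ?posrE// ym// tjt.
      have := qy _ jN; rewrite -/(tj _) -/q ler_norml => /andP[q1 q2].
      have := qy _ (ltnW jN); rewrite -/(tj _) -/q ler_norml => /andP[q3 q4].
      rewrite ler_norml; lra.
    rewrite -dB distrC in H1.
    move: H1 H2 H3; rewrite !ler_norml; lra.
  have -> : Sm t - B t = \sum_(0 <= j < N)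
      ((Sm (tj j.+1) - B (tj j.+1)) - (Sm (tj j) - B (tj j))).
    by rewrite (telescope_sumr (fun j => Sm (tj j) - B (tj j)))// tjN tj0 Sm0 B0; lra.
  apply: (le_trans (ler_norm_sum _ _ _)).
  apply: (@le_trans _ _ (\sum_(0 <= j < N)
     (e * b / 4 * (q (tj j) - q (tj j.+1)) + (k / m) * (2 * eta)
      + e * b / 4 * (y (tj j) - y (tj j.+1))))).
    by rewrite !big_mkord; apply: ler_sum => j _; exact: main.
  rewrite !big_split/= -!mulr_sumr.
  have -> : \sum_(0 <= j < N) (q (tj j) - q (tj j.+1)) = q 0 - q t.
    rewrite -[LHS]opprK -sumrN; under eq_bigr do rewrite opprB.
    by rewrite (telescope_sumr (fun j => q (tj j)))// tjN tj0 opprB.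
  have -> : \sum_(0 <= j < N) (y (tj j) - y (tj j.+1)) = y 0 - y t.
    rewrite -[LHS]opprK -sumrN; under eq_bigr do rewrite opprB.
    by rewrite (telescope_sumr (fun j => y (tj j)))// tjN tj0 opprB.
  rewrite big_const_nat iter_addr_0 subn0 -[_ *+ N]mulr_natr.
  have q1 : q 0 - q t <= 1.
    rewrite lerBlDr (le_trans (surv_freq_le1 A z s n 0))// lerDl.
    exact: surv_freq_ge0.
  have y1 : y 0 - y t <= 1.
    by rewrite lerBlDr (le_trans y0_le1)// lerDl ltW.
  have eb : 0 <= e * b / 4 by rewrite !mulr_ge0// ltW.
  have -> : k / m * (2 * (eta * N%:R)) = eta * N%:R * (2 * k / m) by ring.
  have := ler_piMr eb q1; have := ler_piMr eb y1; lra.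
rewrite -mulrBr normrM normfV (gtr0_norm b0) mulrC ler_pdivrMr//.
Qed.

End deterministic.

(** * Survival function and density of the interarrival times *)

Section jump_law.
Context {R : realType} {X : metricType R} {E : set X} {e0 : E}.

Lemma measurable_state (g : state e0 -> R) : continuous g -> measurable_fun setT g.
Proof.
move=> /continuousP cg; apply: (measurability _ (RGenOpens.measurableE R)).
move=> _ [_ [a [b ->] <-]]; rewrite setTI; apply: sub_sigma_algebra.
exact/cg/interval_open.
Qed.

Lemma continuous_state (g : state e0 -> R) (L : R) :
  (forall x x', `|g x - g x'| <= L * mdist (point_of x) (point_of x')) ->
  continuous g.
Proof.
move=> gL x; apply/(@cvgrPdist_lt _ _ _ _ (nbhs_filter x)) => e e_gt0.
have cv : continuous (fun x : state e0 => point_of x).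
  exact: (@initial_continuous _ _ (set_val : set_type E -> X)).
have L1 : 0 < `|L| + 1 by rewrite ltr_wpDl.
have d0 : 0 < e / (`|L| + 1) by rewrite divr_gt0.
have := @metricType_numDomainType.cvgr_dist_lt R X (state e0) (nbhs x) _ _ _ (cv x) _ d0.
move=> /(_ (nbhs_filter x)); apply: (@filterS _ _ (nbhs_filter x)) => x' xx'.
apply: le_lt_trans (gL _ _) _.
rewrite ltr_pdivlMr// in xx'; apply: le_lt_trans xx'.
rewrite mulrC ler_wpM2l ?mdist_ge0// (le_trans (ler_norm L))//.
by rewrite lerDl.
Qed.

Variables (lambda : state e0 -> R -> R) (tstar : state e0 -> \bar R).
Hypothesis hl : jump_characteristics lambda tstar.

Let lambda0 xi (v : R) : 0 <= v -> 0 <= lambda xi v.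
Proof. exact: (lambda_ge0 hl). Qed.

Lemma integrable_rate xi (s : R) :
  lebesgue_measure.-integrable (`[0, s] : set R) (EFin \o lambda xi).
Proof.
have [s0|s0] := ltP s 0.
  by rewrite set_itv_ge ?bnd_simp -?ltNge//; exact: integrable_set0.
have [M [M0 iM lM]] := lambda_dominated hl.
apply: le_integrable (iM s s0) => //.
  apply/measurable_EFinP; apply: measurable_funS (lambda_measurable hl xi) => //.
  by move=> v; rewrite /= !in_itv/= => /andP[->].
move=> v; rewrite /= in_itv/= => /andP[v0 _]; rewrite lee_fin.
by rewrite !ger0_norm ?lM ?M0 ?lambda0.
Qed.

Lemma survival_gt0 xi (s : R) : 0 < survival lambda xi s.
Proof. exact: expR_gt0. Qed.

Lemma survival_le1 xi (s : R) : survival lambda xi s <= 1.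
Proof.
rewrite /survival -[leRHS]expR0 ler_expR oppr_le0 Rintegral_ge0// => v.
by rewrite /= in_itv/= => /andP[v0 _]; exact: lambda0.
Qed.

(** The dominating function bounds the cumulative rate uniformly in the state. *)
Lemma survival_lower_bound (s : R) : exists2 c, 0 < c &
  forall xi, c <= survival lambda xi s.
Proof.
have [s0|s0] := ltP s 0.
  exists 1 => // xi; rewrite /survival set_itv_ge ?bnd_simp -?ltNge//.
  by rewrite Rintegral_set0 oppr0 expR0.
have [M [M0 iM lM]] := lambda_dominated hl.
exists (expR (- \int[lebesgue_measure]_(v in `[0, s]) M v)); first exact: expR_gt0.
move=> xi; rewrite ler_expR lerN2; apply: le_Rintegral => //.
- exact: integrable_rate.
- exact: iM.
- by move=> v; rewrite /= in_itv/= => /andP[v0 _]; exact: lM.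
Qed.

(** The integral from 0 to s is rewritten as an integral from a fixed point
    [a < 0] of the rate extended by zero, so that continuity of parameterized
    integrals applies around every [s], including 0 and the negative times. *)
Lemma continuous_survival xi : continuous (survival lambda xi).
Proof.
move=> s; suff cint : {for s, continuous
    (fun v : R => \int[lebesgue_measure]_(w in `[0, v]) lambda xi w)}.
  by apply: (continuous_comp (continuousN cint)); exact: continuous_expR.
pose a : R := Num.min s 0 - 1; pose b : R := Num.max s 0 + 1.
have min0 : Num.min s 0 <= 0 by rewrite ge_min lexx orbT.
have mins : Num.min s 0 <= s by rewrite ge_min lexx.
have max0 : 0 <= Num.max s 0 by rewrite le_max lexx orbT.
have maxs : s <= Num.max s 0 by rewrite le_max lexx.
have a0 : a < 0 by rewrite /a; lra.
have as_ : a < s by rewrite /a; lra.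
have b0 : 0 < b by rewrite /b; lra.
have sb : s < b by rewrite /b; lra.
pose l := lambda xi \_ `[0, +oo[%classic.
have lE v : \int[lebesgue_measure]_(w in `[0, v]) lambda xi w =
    \int[lebesgue_measure]_(w in `[a, v]) l w.
  rewrite Rintegral_mkcond [RHS]Rintegral_mkcond; apply: eq_Rintegral => w _.
  rewrite /l !patchE; have [wv|wv] := boolP (w \in `[a, v]%classic).
    have [w0|w0] := boolP (w \in `[0, +oo[%classic).
      rewrite mem_set//; move: wv w0; rewrite !inE/= !in_itv/= andbT.
      by move=> /andP[_ wv] w0; rewrite w0.
    rewrite memNset// => /=; rewrite in_itv/= => /andP[w1 w2].
    by move/negP: w0; apply; rewrite inE/= in_itv/= w1.
  rewrite memNset// => /=; rewrite in_itv/= => /andP[w1 w2].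
  by move/negP: wv; apply; rewrite inE/= in_itv/= w2 andbT (ltW (lt_le_trans a0 w1)).
rewrite (funext lE).
have il : lebesgue_measure.-integrable `[a, b] (EFin \o l).
  have -> : EFin \o l = (EFin \o lambda xi) \_ `[0, +oo[%classic.
    by apply/funext => w; rewrite /l /= !patchE; case: ifPn.
  apply/integrable_restrict => //.
  apply: integrableS (integrable_rate xi b) => //.
    exact: measurableI.
  by move=> w [] /=; rewrite !in_itv/= andbT => /andP[_ ->] ->.
have ab : a <= b by lra.
have := parameterized_integral_continuous ab il.
move=> /continuous_within_itvP; move=> /(_ (lt_trans as_ sb))[+ _ _].
by apply; rewrite in_itv/= as_ sb.
Qed.

(** The density continued to negative times by its value at 0, so that it becomes
    continuous on the whole line and end points need no special treatment. *)
Definition density_ext xi (s : R) := jump_density lambda xi (Num.max s 0).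

Lemma density_extE xi s : 0 <= s -> density_ext xi s = jump_density lambda xi s.
Proof. by move=> s0; rewrite /density_ext max_l. Qed.

Lemma density_ext_ge0 xi s : 0 <= density_ext xi s.
Proof.
rewrite /density_ext mulr_ge0//; last exact: ltW (survival_gt0 _ _).
by rewrite lambda0// le_max lexx orbT.
Qed.

Lemma density_ext_bounded : exists2 C, 0 <= C & forall xi s, density_ext xi s <= C.
Proof.
have [C fC] := density_bounded hl; exists `|C| => // xi s.
rewrite (le_trans (ler_norm _))// (le_trans (fC _ _ _)) ?ler_norm//.
by rewrite le_max lexx orbT.
Qed.

Lemma continuous_density_ext xi : continuous (density_ext xi).
Proof.
move=> s; have /subspace_continuousP fc := @density_continuous _ _ _ _ _ _ hl xi.
have m0 : `[0, +oo[%classic (Num.max s 0) by rewrite /= in_itv/= andbT le_max lexx orbT.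
apply/cvgrPdist_lt => e e_gt0.
have /cvgrPdist_lt/(_ _ e_gt0) := fc _ m0.
rewrite near_withinE => /nbhs_ballP[r /= r0 rP].
apply/nbhs_ballP; exists r => //= v; rewrite /ball/= => sv.
apply: rP; last by rewrite /= in_itv/= andbT le_max lexx orbT.
rewrite /ball/=; apply: le_lt_trans sv.
rewrite /Num.max; case: ifPn => s0; case: ifPn => v0.
- by rewrite subrr normr0.
- by rewrite sub0r normrN; rewrite -leNgt in v0; rewrite !ler_norml ler0_norm; lra.
- by rewrite subr0; rewrite -leNgt in s0; rewrite ler_norml ger0_norm; lra.
- by [].
Qed.

(** Only the product [lambda * G] is assumed continuous in time; dividing by the
    survival function, which is continuous and positive, shows that [lambda]
    is too, and the fundamental theorem of calculus applies. *)
Lemma is_derive_survival xi (s : R) : 0 < s ->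
  is_derive s (1 : R) (survival lambda xi) (- jump_density lambda xi s).
Proof.
move=> s0.
have cl : {for s, continuous (lambda xi)}.
  have : {for s, continuous (fun v => density_ext xi v / survival lambda xi v)}.
    apply: cvgM; first exact: continuous_density_ext.
    by apply: cvgV; [rewrite gt_eqF// survival_gt0|exact: continuous_survival].
  rewrite /prop_for/continuous_at density_extE ?(ltW s0)// /jump_density mulfK ?gt_eqF ?survival_gt0//.
  apply: cvg_trans; apply: near_eq_cvg; near=> v.
  rewrite density_extE; last by rewrite ltW//; near: v; exact: lt_nbhsr.
  by rewrite /jump_density mulfK ?gt_eqF ?survival_gt0.
have s1 : s < s + 1 by rewrite ltrDl.
have [dI I'] := continuous_FTC1_closed s1 (integrable_rate xi (s + 1)) s0 cl.
have dI' : is_derive s (1 : R)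
    (fun v => \int[lebesgue_measure]_(w in `[0, v]) lambda xi w) (lambda xi s).
  by apply: DeriveDef => //; rewrite -derive1E I'.
pose I v := \int[lebesgue_measure]_(w in `[0, v]) lambda xi w.
have := @is_derive1_comp R expR (fun v => - I v) s _ _
  (is_derive_expR _) (is_deriveN dI').
rewrite (_ : _ * _ = - jump_density lambda xi s)//.
by rewrite /jump_density /survival mulrN mulrC.
Unshelve. all: by end_near. Qed.

(** The Lipschitz condition, integrated over [0, s], makes the cumulative rate
    Lipschitz in the state. *)
Lemma measurable_survival (s : R) : measurable_fun setT (survival lambda ^~ s).
Proof.
have [s0|s0] := ltP s 0.
  rewrite (_ : survival lambda ^~ s = cst 1)//; apply/funext => xi.
  by rewrite /survival set_itv_ge ?bnd_simp -?ltNge// Rintegral_set0 oppr0 expR0.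
have [L L0 lL] := lambda_lipschitz hl.
rewrite /survival; apply: measurableT_comp => //; apply: measurableT_comp => //.
apply: measurable_state; apply: (@continuous_state _ (s * L)) => xi xi'.
rewrite -RintegralB//; [|exact: integrable_rate..].
have idiff : lebesgue_measure.-integrable (`[0, s] : set R)
    (EFin \o (fun v => lambda xi v - lambda xi' v)).
  have -> : EFin \o (fun v => lambda xi v - lambda xi' v) =
    ((EFin \o lambda xi) \- (EFin \o lambda xi'))%E by apply/funext.
  by apply: integrableB => //; exact: integrable_rate.
have icst : lebesgue_measure.-integrable (`[0, s] : set R)
    (EFin \o cst (L * mdist (point_of xi) (point_of xi'))).
  apply: continuous_compact_integrable; first exact: segment_compact.
  by apply: continuous_subspaceT => v; exact: cvg_cst.
apply: le_trans (le_normr_Rintegral _ idiff) _ => //.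
apply: (@le_trans _ _ (\int[lebesgue_measure]_(v in `[0, s])
    (cst (L * mdist (point_of xi) (point_of xi')) v))).
  apply: le_Rintegral => //; first exact: integrable_norm idiff.
  by move=> v; rewrite /= in_itv/= => /andP[v0 _]; exact: lL.
rewrite Rintegral_cst//= lebesgue_measure_itv/= lte_fin.
case: ifPn => _; first by rewrite -EFinB subr0 /= mulrC mulrA.
by rewrite mulr0 !mulr_ge0 ?mdist_ge0// ltW.
Qed.

Lemma measurable_density_ext (s : R) : measurable_fun setT (density_ext ^~ s).
Proof.
apply: measurable_funM; last exact: measurable_survival.
have [L L0 lL] := lambda_lipschitz hl.
apply: measurable_state; apply: (@continuous_state _ L) => xi xi'.
by apply: lL; rewrite le_max lexx orbT.
Qed.

End jump_law.

(** * Averages over A of the survival function and of the density *)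

Section limit_functions.
Context {R : realType} {X : metricType R} {E : set X} {e0 : E}.
Variables (lambda : state e0 -> R -> R) (tstar : state e0 -> \bar R).
Hypothesis hl : jump_characteristics lambda tstar.
Variables (nu : probability (state e0) R) (A : set (state e0)).
Hypotheses (mA : measurable A) (nuA : (0 < nu A)%E).

Definition surv_limit (s : R) : R := \int[nu]_(xi in A) survival lambda xi s.
Definition jump_limit (s : R) : R := \int[nu]_(xi in A) density_ext lambda xi s.

Let nuA_fin : (nu A < +oo)%E.
Proof. by rewrite (le_lt_trans (probability_le1 _ _))// ltry. Qed.

Let integrable_survival (s : R) : nu.-integrable A (EFin \o survival lambda ^~ s).
Proof.
apply: measurable_bounded_integrable => //.
  by apply: measurable_funTS; exact: (measurable_survival hl).
exists 1; split => // M M1 xi _ /=; rewrite ger0_norm ?(ltW (survival_gt0 _ _ _))//.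
by rewrite (le_trans (survival_le1 hl _ _))// ltW.
Qed.

Let integrable_density (s : R) : nu.-integrable A (EFin \o density_ext lambda ^~ s).
Proof.
have [C C0 fC] := density_ext_bounded hl.
apply: measurable_bounded_integrable => //.
  by apply: measurable_funTS; exact: (measurable_density_ext hl).
exists C; split => // [|M MC xi _ /=]; first exact: num_real.
rewrite ger0_norm ?(density_ext_ge0 hl)//.
by rewrite (le_trans (fC _ _))// ltW.
Qed.

Let integrable_cst_nu (c : R) : nu.-integrable A (EFin \o cst c).
Proof.
apply: measurable_bounded_integrable => //.
exists `|c|; split => // M cM xi _ /=.
exact: ltW.
Qed.

Lemma surv_limit_gt0 s : 0 < surv_limit s.
Proof.
have [c c0 cS] := survival_lower_bound hl s.
apply: (@lt_le_trans _ _ (\int[nu]_(xi in A) cst c xi)).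
  by rewrite Rintegral_cst// mulr_gt0// fine_gt0// nuA.
by apply: le_Rintegral => // xi _; exact: cS.
Qed.

Lemma surv_limit0_le1 : surv_limit 0 <= 1.
Proof.
apply: (@le_trans _ _ (\int[nu]_(xi in A) cst 1 xi)).
  by apply: le_Rintegral => // xi _; exact: (survival_le1 hl).
rewrite Rintegral_cst// mul1r -lee_fin fineK ?ge0_fin_numE//.
exact: probability_le1.
Qed.

Lemma jump_limit_ge0 s : 0 <= jump_limit s.
Proof. by apply: Rintegral_ge0 => xi _; exact: (density_ext_ge0 hl). Qed.

Lemma continuous_surv_limit : continuous surv_limit.
Proof.
move=> s; have sI : s \in `](s - 1), (s + 1)[%classic.
  by rewrite inE/= in_itv/=; lra.
apply: (continuity_under_integral mA _ _ (integrable_cst_nu 1)) sI.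
- by move=> v _; exact: integrable_survival.
- by apply: aeW => xi _ v _; exact: (continuous_survival hl).
- move=> v _; apply: aeW => xi _.
  by rewrite ger0_norm ?(survival_le1 hl)// ltW// survival_gt0.
Qed.

Lemma continuous_jump_limit : continuous jump_limit.
Proof.
have [C C0 fC] := density_ext_bounded hl.
move=> s; have sI : s \in `](s - 1), (s + 1)[%classic.
  by rewrite inE/= in_itv/=; lra.
apply: (continuity_under_integral mA _ _ (integrable_cst_nu C)) sI.
- by move=> v _; exact: integrable_density.
- by apply: aeW => xi _ v _; exact: (continuous_density_ext hl).
- move=> v _; apply: aeW => xi _.
  by rewrite ger0_norm ?fC// (density_ext_ge0 hl).
Qed.

(** Differentiation under the integral sign, dominated by the bound on the
    density. *)
Lemma is_derive_surv_limit (s : R) : 0 < s ->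
  is_derive s (1 : R) surv_limit (- jump_limit s).
Proof.
move=> s0; have [C C0 fC] := density_ext_bounded hl.
have sI : `]0, (s + 1)[%classic s by rewrite /= in_itv/= s0/= ltrDl.
pose f v xi := survival lambda xi v.
have df v xi : `]0, (s + 1)[%classic v -> is_derive v (1 : R) (f ^~ xi)
    (- density_ext lambda xi v).
  rewrite /= in_itv/= => /andP[v0 _]; rewrite density_extE ?(ltW v0)//.
  exact: (is_derive_survival hl).
have d1 v xi : `]0, (s + 1)[%classic v -> partial1of2 f v xi =
    - density_ext lambda xi v.
  by move=> vI; rewrite partial1of2E; have dvxi := df v xi vI; rewrite derive_val.
have H1 v : `]0, (s + 1)[%classic v -> nu.-integrable A (EFin \o f v).
  by move=> _; exact: integrable_survival.
have H2 v xi : `]0, (s + 1)[%classic v -> A xi -> derivable (f ^~ xi) v 1.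
  by move=> vI _; have dvxi := df v xi vI; exact: ex_derive.
have H3 v xi : `]0, (s + 1)[%classic v -> A xi -> `|partial1of2 f v xi| <= cst C xi.
  by move=> vI _; rewrite d1// normrN ger0_norm ?fC// (density_ext_ge0 hl).
have intC := integrable_cst_nu C.
apply: DeriveDef.
  exact: (derivable_under_integral mA sI H1 H2 (fun=> C0) intC H3).
rewrite -derive1E (differentiation_under_integral mA sI H1 H2 (fun=> C0) intC H3).
rewrite (_ : - jump_limit s = \int[nu]_(xi in A) ((-1) * density_ext lambda xi s)).
  by apply: eq_Rintegral => xi _; rewrite d1// mulN1r.
by rewrite RintegralZl// mulN1r.
Qed.

Lemma integral_jump_limit (a b : R) : 0 <= a -> a <= b ->
  \int[lebesgue_measure]_(v in `]a, b]) jump_limit v = surv_limit a - surv_limit b.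
Proof.
move=> a0; rewrite le_eqVlt => /predU1P[<-|ab].
  by rewrite set_itvoc0 Rintegral_set0 subrr.
have cJ := continuous_jump_limit.
rewrite Rintegral_itv_obnd_cbnd; last exact: continuous_integrable_itvoc.
have := @continuous_FTC2 R jump_limit (fun v => - surv_limit v) a b ab.
rewrite /Rintegral => ->/=; first by rewrite opprK addrC.
- exact: continuous_subspaceT.
- have cN : continuous (fun v => - surv_limit v).
    by move=> v; apply: cvgN; exact: continuous_surv_limit.
  split.
  + move=> v; rewrite in_itv/= => /andP[av _].
    have := is_derive_surv_limit (le_lt_trans a0 av).
    by move=> dv; apply: derivableN; exact: ex_derive.
  + by apply: cvg_at_right_filter; exact: cN.
  + by apply: cvg_at_left_filter; exact: cN.
- move=> v; rewrite in_itv/= => /andP[av _].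
  have dv := is_derive_surv_limit (le_lt_trans a0 av).
  rewrite derive1E (_ : (fun v => - surv_limit v) = - surv_limit)//.
  by rewrite deriveN ?derive_val ?opprK//; exact: ex_derive.
Qed.

Lemma limit_rateE (u : R) : 0 <= u ->
  limit_rate lambda nu A u = jump_limit u / surv_limit u.
Proof.
move=> u0; suff -> : jump_limit u = \int[nu]_(xi in A) jump_density lambda xi u.
  by [].
by apply: eq_Rintegral => xi _; rewrite density_extE.
Qed.

End limit_functions.

(** * Integration: induction, total variation, disintegration *)

Section nonnegative_induction.
Context {d} {T : measurableType d} {R : realType}.
Local Open Scope ereal_scope.

Import HBNNSimple.

(** The standard machine: nonnegative measurable functions are generated from
    indicators by sums, scalings and increasing limits. *)
Lemma measurable_fun_ind (Phi : (T -> \bar R) -> Prop) :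
  (forall D, measurable D -> Phi (fun x => (\1_D x)%:E)) ->
  (forall f g, measurable_fun setT f -> measurable_fun setT g ->
    (forall x, 0 <= f x) -> (forall x, 0 <= g x) ->
    Phi f -> Phi g -> Phi (f \+ g)) ->
  (forall (c : R) f, (0 <= c)%R -> measurable_fun setT f ->
    (forall x, 0 <= f x) -> Phi f -> Phi (fun x => c%:E * f x)) ->
  (forall f_ : nat -> T -> \bar R, (forall n, measurable_fun setT (f_ n)) ->
    (forall n x, 0 <= f_ n x) -> (forall x, nondecreasing_seq (f_ ^~ x)) ->
    (forall n, Phi (f_ n)) -> Phi (fun x => limn (f_ ^~ x))) ->
  forall f, measurable_fun setT f -> (forall x, 0 <= f x) -> Phi f.
Proof.
move=> PhiI PhiD PhiZ Phil f mf f0.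
pose f_ := nnsfun_approx measurableT mf.
have -> : f = fun x => limn (fun n => (f_ n x)%:E).
  by apply/funext => x; apply/esym/cvg_lim => //; exact: cvg_nnsfun_approx.
apply: (Phil (fun n x => (f_ n x)%:E)).
- by move=> n; exact/measurable_EFinP.
- by move=> n x; rewrite lee_fin.
- by move=> x a b ab; rewrite lee_fin; exact/lefP/nd_nnsfun_approx.
move=> n; have fE : (fun x => (f_ n x)%:E) = (fun x => \sum_(y <- enum_fset (fset_set (range (f_ n))))
    (y * \1_(f_ n @^-1` [set y]) x)%:E).
  by apply/funext => x; rewrite sumEFin fimfunE fsbig_finite.
rewrite fE; have : {subset enum_fset (fset_set (range (f_ n))) <= [pred y | 0 <= y]%R}.
  move=> y yf; have : y \in fset_set (range (f_ n)) by [].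
  by rewrite in_fset_set// => /set_mem[x _ <-]; rewrite inE; exact: fun_ge0.
elim: (enum_fset _) => [|y s IH] ys.
  rewrite (_ : (fun _ => _) = (fun x => (\1_(set0 : set T) x)%:E)).
    by apply: PhiI; exact: measurable0.
  by apply/funext => x; rewrite big_nil indic0.
rewrite (_ : (fun _ => _) = (fun x => y%:E * (\1_(f_ n @^-1` [set y]) x)%:E) \+
    (fun x => \sum_(y <- s) (y * \1_(f_ n @^-1` [set y]) x)%:E)); last first.
  by apply/funext => x; rewrite big_cons.
have y0 : (0 <= y)%R by apply: ys; rewrite mem_head.
have s0 : {subset s <= [pred y | 0 <= y]%R}.
  by move=> v vs; apply: ys; rewrite in_cons vs orbT.
have mI D : measurable D -> measurable_fun setT (fun x : T => (\1_D x)%:E : \bar R).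
  by move=> mD; exact/measurable_EFinP/measurable_indic.
have I0 D (x : T) : 0 <= (\1_D x)%:E :> \bar R by rewrite lee_fin indicE.
apply: PhiD.
- by apply: measurable_funeM; exact: mI.
- apply: emeasurable_sum => v; apply/measurable_EFinP.
  by apply: measurable_funM => //; exact: measurable_indic.
- by move=> x; rewrite mule_ge0.
- move=> x; rewrite big_seq; apply: sume_ge0 => v vs.
  by rewrite EFinM mule_ge0// lee_fin; exact: s0.
- by apply: PhiZ => //; [exact: mI|exact: PhiI].
- exact: IH.
Qed.

End nonnegative_induction.

Section total_variation.
Context {d} {T : measurableType d} {R : realType}.

(** Counting the thresholds j/N below [p] recovers [p] up to 1/N. *)
Lemma layer_cake_approx (N : nat) (p : R) : (0 < N)%N -> 0 <= p <= 1 ->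
  `|p - N%:R^-1 * \sum_(j < N) ((j.+1%:R / N%:R <= p)%R)%:R| <= N%:R^-1.
Proof.
move=> N0 /andP[p0 p1]; have N0' : 0 < N%:R :> R by rewrite ltr0n.
pose k := Num.truncn (p * N%:R).
have pN0 : 0 <= p * N%:R by rewrite mulr_ge0.
have /andP[k1 k2] : k%:R <= p * N%:R < k.+1%:R by exact: truncn_itv.
have kN : (k <= N)%N.
  rewrite -(ler_nat R) (le_trans k1)// -[leRHS]mul1r ler_wpM2r//.
have -> : \sum_(j < N) ((j.+1%:R / N%:R <= p)%R)%:R = k%:R :> R.
  rewrite -natr_sum; congr _%:R.
  rewrite (eq_bigr (fun j : 'I_N => (j < k)%N : nat)); last first.
    move=> j _; congr nat_of_bool; rewrite ler_pdivrMr//.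
    have [jk|jk] := ltnP j k; first by rewrite (le_trans _ k1)// ler_nat.
    by apply/negbTE; rewrite -ltNge (lt_le_trans k2)// ler_nat ltnS.
  rewrite -(big_mkord xpredT (fun j => (j < k)%N : nat)) -big_mkcond/=.
  rewrite -(big_nat_widen 0 k N xpredT (fun=> 1%N))//.
  by rewrite sum_nat_const_nat subn0 muln1.
rewrite -(ler_pM2l N0') -{1}(gtr0_norm N0') -normrM mulrBr mulVKf ?gt_eqF//.
by rewrite divff ?gt_eqF// mulrC ler_norml; move: k1 k2; rewrite -natr1; lra.
Qed.

Lemma integrable01 (mu : {finite_measure set T -> \bar R}) (p : T -> R) :
  measurable_fun setT p -> (forall x, 0 <= p x <= 1) ->
  mu.-integrable setT (EFin \o p).
Proof.
move=> mp p01; apply: measurable_bounded_integrable => //.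
  by rewrite ltey_eq fin_num_measure.
exists 1; split => // M M1 x _ /=; have /andP[p0 p1] := p01 x.
by rewrite ger0_norm// (le_trans p1)// ltW.
Qed.

(** A function with values in [0, 1] is, up to 1/N, an average of [N] indicators of
    its upper level sets, and each of these is integrated within [r] by the two
    probabilities. *)
Lemma tv_integral (mu mu' : probability T R) (r : R) (p : T -> R) :
  (forall B, measurable B -> `|fine (mu B) - fine (mu' B)| <= r) ->
  measurable_fun setT p -> (forall x, 0 <= p x <= 1) ->
  `|\int[mu]_x p x - \int[mu']_x p x| <= r.
Proof.
move=> mur mp p01; apply/ler_addgt0Pr => e e0.
pose N := (Num.truncn (2 / e)).+1.
have N0 : 0 < N%:R :> R by rewrite ltr0n.
have Ne : 2 / N%:R <= e.
  by rewrite ler_pdivrMr// mulrC -ler_pdivrMr//; apply/ltW/truncnS_gt.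
pose D j := [set x | (j.+1%:R / N%:R <= p x)%R].
have mD j : measurable (D j).
  by rewrite -[D j]setTI; exact: measurable_fun_le.
pose s x := N%:R^-1 * \sum_(j < N) \1_(D j) x : R.
have sP x : `|p x - s x| <= N%:R^-1.
  rewrite /s (eq_bigr (fun j : 'I_N => ((j.+1%:R / N%:R <= p x)%R)%:R)).
    exact: layer_cake_approx.
  move=> j _; rewrite indicE (_ : (x \in D j) = (j.+1%:R / N%:R <= p x))//.
  by apply/idP/idP => [/set_mem|h]//; exact/mem_set.
have ms : measurable_fun setT s.
  apply: measurable_funM => //; apply: measurable_sum => j.
  exact: measurable_indic.
have s01 x : 0 <= s x <= 1.
  apply/andP; split.
    by rewrite mulr_ge0 ?invr_ge0// sumr_ge0// => j _; rewrite indicE.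
  rewrite ler_pdivrMl// mulr1 -[leRHS](_ : \sum_(i < N) 1 = _).
    by apply: ler_sum => j _; rewrite indicE lern1 leq_b1.
  by rewrite sumr_const card_ord.
have intS (m : probability T R) :
    \int[m]_x s x = N%:R^-1 * \sum_(j < N) fine (m (D j)).
  have -> : \int[m]_x s x = fine (\int[m]_x (N%:R^-1%:E * \sum_(j < N) (\1_(D j) x)%:E))%E.
    by congr fine; apply: eq_integral => x _; rewrite sumEFin.
  rewrite ge0_integralZl//=; first last.
  - by move=> x _; apply: sume_ge0 => j _; rewrite lee_fin indicE.
  - by apply: emeasurable_sum => j; exact/measurable_EFinP/measurable_indic.
  rewrite ge0_integral_sum//; last first.
    by move=> j; exact/measurable_EFinP/measurable_indic.
  rewrite (eq_bigr (fun j : 'I_N => (fine (m (D j)))%:E)); last first.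
    by move=> j _; rewrite integral_indic// setIT fineK// fin_num_measure.
  by rewrite sumEFin.
have close (Pr : probability T R) : `|\int[Pr]_x p x - \int[Pr]_x s x| <= N%:R^-1.
  have ip := integrable01 Pr mp p01; have is_ := integrable01 Pr ms s01.
  rewrite -RintegralB//.
  have ips : Pr.-integrable setT (EFin \o (fun x => p x - s x)).
    have -> : EFin \o (fun x => p x - s x) = ((EFin \o p) \- (EFin \o s))%E.
      by apply/funext.
    exact: integrableB.
  apply: le_trans (le_normr_Rintegral _ ips) _ => //.
  apply: (@le_trans _ _ (\int[Pr]_x (cst N%:R^-1 x))).
    apply: le_Rintegral => //; first exact: integrable_norm ips.
    exact: finite_measure_integrable_cst.
  rewrite Rintegral_cst// ler_piMr ?invr_ge0// -lee_fin fineK ?probability_le1//.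
  exact: fin_num_measure.
have sr : `|\int[mu]_x s x - \int[mu']_x s x| <= r.
  rewrite !intS -mulrBr normrM ger0_norm ?invr_ge0// ler_pdivrMl// -sumrB.
  apply: (le_trans (ler_norm_sum _ _ _)).
  rewrite mulr_natl -[in leRHS](card_ord N) -sumr_const.
  by apply: ler_sum => j _; exact: mur.
have := close mu; have := close mu'; move: sr; rewrite !ler_norml.
lra.
Qed.

End total_variation.
Section disintegration.
Context {d d'} {Om : measurableType d} {T : measurableType d'} {R : realType}.
Local Open Scope ereal_scope.

(** Both the Markov property and conditional probabilities given the past are
    formulas for sets; this extends them to functions. The measure
    [k w] is the conditional law of [V], possibly weighted. *)
Lemma integral_disintegration (P : probability Om R) (C1 C2 : set Om)
    (V : Om -> T) (k : Om -> {measure set T -> \bar R}) :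
  measurable C1 -> measurable C2 -> measurable_fun setT V ->
  (forall D, measurable D -> measurable_fun setT (k ^~ D)) ->
  (forall D, measurable D -> P (V @^-1` D `&` C1) = \int[P]_(w in C2) k w D) ->
  forall f, measurable_fun setT f -> (forall x, 0 <= f x) ->
    \int[P]_(w in C1) f (V w) = \int[P]_(w in C2) \int[k w]_y f y.
Proof.
move=> mC1 mC2 mV mk PV.
have mkf (f : T -> \bar R) : measurable_fun setT f -> (forall x, 0 <= f x) ->
    measurable_fun C2 (fun w => \int[k w]_y f y).
  by move=> mf f0; apply: measurable_funTS; exact: measurable_fun_integral_kernel.
have mVf (f : T -> \bar R) : measurable_fun setT f -> measurable_fun C1 (f \o V).
  by move=> mf; apply: measurable_funTS; exact: measurableT_comp.
apply: measurable_fun_ind.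
- move=> D mD; under [RHS]eq_integral do rewrite integral_indic// setIT.
  by rewrite -PV// -integral_indic//; rewrite -[V @^-1` D]setTI; exact: mV.
- move=> f g mf mg f0 g0 Hf Hg.
  rewrite ge0_integralD//;
    try by [exact: mVf|exact: mkf|move=> *; exact: integral_ge0|move=> *; exact: f0].
  rewrite Hf Hg -ge0_integralD//;
    try by [exact: mVf|exact: mkf|move=> *; exact: integral_ge0|move=> *; exact: f0].
  by apply: eq_integral => w _; rewrite ge0_integralD.
- move=> c f c0 mf f0 Hf.
  rewrite ge0_integralZl//;
    try by [exact: mVf|exact: mkf|move=> *; exact: integral_ge0|move=> *; exact: f0].
  rewrite Hf -ge0_integralZl//;
    try by [exact: mVf|exact: mkf|move=> *; exact: integral_ge0|move=> *; exact: f0].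
  by apply: eq_integral => w _; rewrite ge0_integralZl.
- move=> f_ mf f0 ndf Hf.
  rewrite monotone_convergence//;
    try by [move=> n; exact: mVf|move=> *; exact: f0].
  rewrite (funext Hf) -monotone_convergence//.
  + by apply: eq_integral => w _; rewrite monotone_convergence.
  + by move=> n; exact: mkf.
  + by move=> n w _; exact: integral_ge0.
  + by move=> w _ a b ab; apply: ge0_le_integral => // y _; exact: ndf.
Qed.

(** The law of [V] restricted to [B] has, conditionally on [G], the density
    [g] with respect to the Dirac mass at [V]. *)
Lemma cond_prob_integral (P : probability Om R) (G : set (set Om)) (B C : set Om)
    (V : Om -> T) (g : Om -> R) :
  G `<=` measurable -> setI_closed G -> measurable B ->
  (forall w, 0 <= g w)%R ->
  is_cond_prob P G B (fun w => (g w)%:E) ->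
  (forall D, measurable D -> G (V @^-1` D)) -> G C ->
  forall f, measurable_fun setT f -> (forall x, 0 <= f x) ->
    \int[P]_(w in B `&` C) f (V w) = \int[P]_(w in C) ((g w)%:E * f (V w)).
Proof.
move=> Gm GI mB g0 [mg PBg] GV GC f mf f0.
have mgE : measurable_fun setT (fun w => (g w)%:E).
  by move=> _ D mD; apply: Gm; apply: mg; exists D.
have mV : measurable_fun setT V.
  by move=> _ D mD; rewrite setTI; exact/Gm/GV.
pose k w : {measure set T -> \bar R} := mscale (NngNum (g0 w)) \d_(V w).
rewrite (@integral_disintegration P (B `&` C) C V k)//.
- apply: eq_integral => w _; rewrite ge0_integral_mscale// integral_dirac//.
  by rewrite diracT mul1e.
- by apply: measurableI => //; exact: Gm.
- exact: Gm.
- move=> D mD; rewrite /k /mscale/=; apply: emeasurable_funM => //.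
  apply/measurable_EFinP; rewrite (_ : (fun w => _) = \1_(V @^-1` D))//.
  by apply: measurable_indic; rewrite -[_ @^-1` _]setTI; exact: mV.
- move=> D mD; rewrite setICA PBg; last by apply: GI => //; exact: GV.
  by rewrite integral_mkcondl epatch_indic; apply: eq_integral => w _.
Qed.

End disintegration.

(** * Moments of a Markov chain *)

Section kernel_action.
Context {d} {T : measurableType d} {R : realType} (Q : R.-pker T ~> T).
Local Open Scope ereal_scope.

(** The operator written Q f in probability theory; its iterates are the
    transition operators of the chain. *)
Definition kernel_act (f : T -> \bar R) (z : T) : \bar R := \int[Q z]_y f y.

Lemma measurable_kernel_act n f : measurable_fun setT f -> (forall x, 0 <= f x) ->
  measurable_fun setT (iter n kernel_act f) /\ forall x, 0 <= iter n kernel_act f x.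
Proof.
move=> mf f0; elim: n => //= n [mn n0]; split.
  by apply: measurable_fun_integral_kernel => // U mU; exact: measurable_kernel.
by move=> x; exact: integral_ge0.
Qed.

Lemma kernel_act_le1 n f : measurable_fun setT f -> (forall x, 0 <= f x <= 1) ->
  forall x, iter n kernel_act f x <= 1.
Proof.
move=> mf f01; have f0 x : 0 <= f x by have /andP[] := f01 x.
elim: n => [x|n IH x] /=; first by have /andP[] := f01 x.
have [mn n0] := measurable_kernel_act n mf f0.
rewrite -(@prob_kernel _ _ _ _ _ Q x) -[leRHS]mul1e -integral_cst//.
exact: ge0_le_integral.
Qed.

End kernel_action.

Section generated_sigma_algebra.
Context {T : pointedType} (F : set (set T)).

Lemma sigma_setI : setI_closed <<s F >>.
Proof. by move=> A B; exact: (@measurableI _ (g_sigma_algebraType F)). Qed.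

End generated_sigma_algebra.

Lemma sigma_measurable {d} {Om : measurableType d} (F : set (set Om)) :
  F `<=` measurable -> <<s F >> `<=` measurable.
Proof. by move=> Fm; apply: smallest_sub => //; exact: sigma_algebra_measurable. Qed.

Section events.
Context {d d'} {Om : measurableType d} {T : measurableType d'}.
Variables (Z : nat -> Om -> T).
Hypothesis mZ : forall n, measurable_fun setT (Z n).

Lemma events_measurable J : events Z J `<=` measurable.
Proof. by move=> _ [j _ [D mD <-]]; apply: mZ. Qed.

Lemma eventsP (J : set nat) j D : J j -> measurable D -> events Z J (Z j @^-1` D).
Proof. by move=> Jj mD; exists j => //; exists D => //; rewrite setTI. Qed.

End events.

Section markov_moments.
Context {d d'} {Om : measurableType d} {T : measurableType d'} {R : realType}.
Variables (P : probability Om R) (mu0 : probability T R) (Q : R.-pker T ~> T)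
  (Z : nat -> Om -> T).
Hypothesis hZ : markov_chain P mu0 Q Z.
Local Open Scope ereal_scope.

Let mZ n : measurable_fun setT (Z n). Proof. by case: hZ. Qed.

Lemma markov_step n C f : <<s events Z `I_n.+1 >> C ->
  measurable_fun setT f -> (forall x, 0 <= f x) ->
  \int[P]_(w in C) f (Z n.+1 w) = \int[P]_(w in C) kernel_act Q f (Z n w).
Proof.
move=> GC mf f0; have mC : measurable C.
  exact: sigma_measurable (events_measurable mZ (J := `I_n.+1)) _ GC.
apply: (@integral_disintegration _ _ _ _ _ _ _ _ _ (fun w => Q (Z n w))) => //.
  by move=> D mD; exact: measurableT_comp (measurable_kernel Q D mD) (mZ n).
by case: hZ => _ _ QZ D mD; have [_] := QZ n D mD; exact.
Qed.

(** The bound on [g] keeps it finite, so that limits pass through the product. *)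
Lemma markov_step_product i n f g : (i <= n)%N ->
  measurable_fun setT f -> (forall x, 0 <= f x) ->
  measurable_fun setT g -> (forall x, 0 <= g x <= 1) ->
  \int[P]_w (f (Z i w) * g (Z n.+1 w)) =
  \int[P]_w (f (Z i w) * kernel_act Q g (Z n w)).
Proof.
move=> ik mf f0 mg g01; move: f mf f0.
have g0 x : 0 <= g x by have /andP[] := g01 x.
have mgZ : measurable_fun setT (g \o Z n.+1) by exact: measurableT_comp.
have [mQ Q0] : measurable_fun setT (kernel_act Q g) /\
    forall z, 0 <= kernel_act Q g z := measurable_kernel_act Q 1 mg g0.
have mQZ : measurable_fun setT (kernel_act Q g \o Z n) by exact: measurableT_comp.
have mfZ (f : T -> \bar R) : measurable_fun setT f -> measurable_fun setT (f \o Z i).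
  by move=> mf; exact: measurableT_comp.
have mprod (f : T -> \bar R) (h : Om -> \bar R) : measurable_fun setT f ->
    measurable_fun setT h -> measurable_fun setT (fun w => f (Z i w) * h w).
  by move=> mf mh; apply: emeasurable_funM => //; exact: mfZ.
have indE (D : set T) (h : Om -> \bar R) :
    (fun w => (\1_D (Z i w))%:E * h w) = h \_ (Z i @^-1` D).
  by rewrite epatch_indic; apply/funext => w; rewrite muleC.
apply: measurable_fun_ind.
- move=> D mD; rewrite !indE -!integral_mkcond; apply: markov_step => //.
  by apply: sub_sigma_algebra; exact: eventsP.
- move=> f f' mf mf' f0 f'0 Hf Hf'.
  have addE (h : Om -> \bar R) : (forall w, 0 <= h w) -> measurable_fun setT h ->
      \int[P]_w ((f \+ f') (Z i w) * h w) =
      \int[P]_w (f (Z i w) * h w) + \int[P]_w (f' (Z i w) * h w).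
    move=> h0 mh; rewrite -ge0_integralD//.
    + by apply: eq_integral => w _; rewrite ge0_muleDl.
    + by move=> w _; rewrite mule_ge0.
    + exact: mprod.
    + by move=> w _; rewrite mule_ge0.
    + exact: mprod.
  by rewrite !addE ?Hf ?Hf'.
- move=> c f c0 mf f0 Hf.
  have mulE (h : Om -> \bar R) : (forall w, 0 <= h w) -> measurable_fun setT h ->
      \int[P]_w (c%:E * f (Z i w) * h w) = c%:E * \int[P]_w (f (Z i w) * h w).
    move=> h0 mh; rewrite -ge0_integralZl//.
    + by apply: eq_integral => w _; rewrite muleA.
    + exact: mprod.
    + by move=> w _; rewrite mule_ge0.
  by rewrite !mulE ?Hf.
- move=> f_ mf f0 ndf Hf.
  have limE (h : Om -> \bar R) : (forall w, 0 <= h w <= 1) ->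
      measurable_fun setT h ->
      \int[P]_w (limn (fun m => f_ m (Z i w)) * h w) =
      limn (fun m => \int[P]_w (f_ m (Z i w) * h w)).
    move=> h01 mh; have h0 w : 0 <= h w by have /andP[] := h01 w.
    rewrite -monotone_convergence//.
    + apply: eq_integral => w _.
      rewrite -limeMr//; last exact: ereal_nondecreasing_is_cvgn.
      rewrite ge0_fin_numE//; have /andP[_ h1] := h01 w.
      exact: le_lt_trans h1 (ltry _).
    + by move=> m; exact: mprod.
    + by move=> m w _; exact: mule_ge0.
    + by move=> w _ a b ab; apply: lee_wpmul2r => //; exact: ndf.
  rewrite !limE//; first by congr (limn _); exact/funext.
  by move=> w; rewrite Q0 (kernel_act_le1 Q 1 mg g01).
Qed.

Lemma markov_step_iter i n f g :
  measurable_fun setT f -> (forall x, 0 <= f x) ->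
  measurable_fun setT g -> (forall x, 0 <= g x <= 1) ->
  \int[P]_w (f (Z i w) * g (Z (i + n)%N w)) =
  \int[P]_w (f (Z i w) * iter n (kernel_act Q) g (Z i w)).
Proof.
move=> mf f0; elim: n g => [|n IH] g mg g01; first by rewrite addn0.
have g0 x : 0 <= g x by have /andP[] := g01 x.
have [mQ Q0] : measurable_fun setT (kernel_act Q g) /\
    forall z, 0 <= kernel_act Q g z := measurable_kernel_act Q 1 mg g0.
have Q01 x : 0 <= kernel_act Q g x <= 1 by rewrite Q0 (kernel_act_le1 Q 1 mg g01).
by rewrite addnS markov_step_product ?leq_addr// iterSr IH.
Qed.

Lemma markov_initial f : measurable_fun setT f -> (forall x, 0 <= f x) ->
  \int[P]_w f (Z 0 w) = \int[mu0]_x f x.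
Proof.
move=> mf f0; rewrite (eq_measure_integral (pushforward P (Z 0%N))); last first.
  by case: hZ => _ Z0 _ B mB _; exact/esym/Z0.
by rewrite ge0_integral_pushforward//= preimage_setT.
Qed.

End markov_moments.

Section markov_from_point.
Context {d d'} {Om : measurableType d} {T : measurableType d'} {R : realType}.
Variables (P : probability Om R) (x : T) (Q : R.-pker T ~> T)
  (Z : nat -> Om -> T).
Hypothesis hZ : markov_chain P (\d_x : probability T R) Q Z.
Local Open Scope ereal_scope.

(** Started from [x], the chain has Q^n f (x) as the expectation of f (Z_n). This
    expresses moments in a form that is visibly measurable in [x]. *)
Lemma markov_expectation n f : measurable_fun setT f ->
  (forall y, 0 <= f y <= 1) ->
  \int[P]_w f (Z n w) = iter n (kernel_act Q) f x.
Proof.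
move=> mf f01; have f0 y : 0 <= f y by have /andP[] := f01 y.
have := markov_step_iter hZ 0 n (measurable_cst 1) (fun=> @lee01 R) mf f01.
under eq_integral do rewrite mul1e add0n.
under [X in _ = X -> _]eq_integral do rewrite mul1e.
move=> ->; have [mn n0] := measurable_kernel_act Q n mf f0.
by rewrite (markov_initial hZ)// integral_dirac// diracT mul1e.
Qed.

End markov_from_point.

(** * Joint law of the counted events *)

(** Conditionally on Z_i = z, the probability that [i] is counted at time [tau], as
    long as no censorship occurs on [A] before [tau]. *)
Definition surviving_from {R : realType} {X : metricType R} {E : set X} {e0 : E}
    (lambda : state e0 -> R -> R) (A : set (state e0)) (tau : R) (z : state e0) : R :=
  \1_A z * survival lambda z tau.

Definition surv_event {R : realType} {T Om : Type} (Z : nat -> Om -> T)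
    (S : nat -> Om -> \bar R) (A : set T) (tau : R) (i : nat) : set Om :=
  Z i @^-1` A `&` [set w | (tau%:E < S i.+1 w)%E].

Section jump_events.
Context {R : realType} {X : metricType R} {E : set X} {e0 : E}.
Context {dO dF dD : measure_display} {Om : measurableType dO}
  {Fe : measurableType dF} {De : measurableType dD}.
Context {P : probability (state e0) R -> probability Om R}
  {Q : R.-pker (state e0) ~> (state e0)}
  {lambda : state e0 -> R -> R} {tstar : state e0 -> \bar R}
  {psi : state e0 * Fe -> state e0} {phi : state e0 * De -> \bar R}
  {eps : nat -> Om -> Fe} {delta : nat -> Om -> De}
  {Z : nat -> Om -> state e0} {S : nat -> Om -> \bar R}.
Hypothesis model : renewal_model P Q lambda tstar psi phi eps delta Z S.
Hypothesis hl : jump_characteristics lambda tstar.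
Local Open Scope ereal_scope.

Lemma measurable_Z n : measurable_fun setT (Z n).
Proof. by case: (Z_markov model (P := P) \d_point). Qed.

Lemma measurable_S n : measurable_fun setT (S n).
Proof.
case: n => [|n].
  by rewrite (_ : S 0%N = cst 0)//; apply/funext => w; rewrite (S_0 model).
rewrite (_ : S n.+1 = phi \o (fun w => (Z n w, delta n w))); last first.
  by apply/funext => w; rewrite (S_rec model).
apply: measurableT_comp; first exact: (phi_measurable model).
by apply: measurable_fun_pair; [exact: measurable_Z|exact: (delta_measurable model)].
Qed.

Variables (A : set (state e0)) (tau : R).
Hypotheses (mA : measurable A) (tau0 : (0 <= tau)%R)
  (tauA : forall z, A z -> tau%:E < tstar z).

Local Notation sv := (surviving_from lambda A tau).
Local Notation ev := (surv_event Z S A tau).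

Let h (z : state e0) : \bar R := (sv z)%:E.

Lemma measurable_surviving_from : measurable_fun setT sv.
Proof.
apply: measurable_funM; first exact: measurable_indic.
exact: (measurable_survival hl).
Qed.

Lemma surviving_from01 z : (0 <= sv z <= 1)%R.
Proof.
have S0 := survival_gt0 lambda z tau; have S1 := survival_le1 hl z tau.
rewrite /surviving_from indicE; case: (_ \in A) => /=; rewrite ?mul1r ?mul0r.
  by rewrite ltW.
by rewrite lexx/=.
Qed.

Lemma measurable_surv_event i : measurable (ev i).
Proof.
apply: measurableI; first by rewrite -[_ @^-1` _]setTI; exact: measurable_Z.
by rewrite -[[set w | _]]setTI; apply: emeasurable_fun_o_infty => //; exact: measurable_S.
Qed.

Let mh : measurable_fun setT h.
Proof. by apply/measurable_EFinP; exact: measurable_surviving_from. Qed.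

Let h01 z : 0 <= h z <= 1.
Proof. by rewrite !lee_fin surviving_from01. Qed.

Let h0 z : 0 <= h z. Proof. by have /andP[] := h01 z. Qed.

Let past n := <<s events Z setT `|` events S `I_n.+1 >>.

Let past_measurable n : past n `<=` measurable.
Proof.
apply: sigma_measurable => C [|].
  by move/(events_measurable measurable_Z).
by move/(events_measurable measurable_S).
Qed.

Let past_Z n k D : measurable D -> past n (Z k @^-1` D).
Proof. by move=> mD; apply: sub_sigma_algebra; left; exact: eventsP. Qed.

Let past_surv_event n i : (i < n)%N -> past n (ev i).
Proof.
move=> iN; apply: sigma_setI; first exact: past_Z.
apply: sub_sigma_algebra; right.
rewrite (_ : [set w | _] = S i.+1 @^-1` `]tau%:E, +oo[%classic).
  by apply: eventsP => //; exact: emeasurable_itv.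
by apply/seteqP; split => w /=; rewrite in_itv/= andbT.
Qed.

Let censored_restrict k :
  (fun w => (survival_censored lambda tstar (Z k w) tau)%:E) \_ (Z k @^-1` A) =
  (fun w => h (Z k w)) :> (Om -> \bar R).
Proof.
apply/funext => w; rewrite patchE /h /surviving_from indicE.
rewrite (_ : (w \in Z k @^-1` A) = (Z k w \in A))//.
case: ifPn => [/set_mem Az|_] /=; last by rewrite mul0r.
by rewrite mul1r /survival_censored tauA// mulr1.
Qed.

Lemma prob_surv_event nu0 i : P nu0 (ev i) = \int[P nu0]_w h (Z i w).
Proof.
have [_ H] := S_law_past model nu0 i tau0.
rewrite /surv_event setIC H; last exact: past_Z.
by rewrite integral_mkcond censored_restrict.
Qed.

(** Condition first on the past of S_(k+1), which contains everything about index
    [i], then on the past of S_(i+1): that past contains the whole chain, in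
    particular Z_k, so the factor produced by the first step comes out. *)
Lemma prob_surv_eventI nu0 i k : (i < k)%N ->
  P nu0 (ev i `&` ev k) = \int[P nu0]_w (h (Z i w) * h (Z k w)).
Proof.
move=> ik; have [_ H] := S_law_past model nu0 k tau0.
rewrite [X in _ `&` X]/surv_event setIA setIC H; last first.
  by apply: sigma_setI; [exact: past_surv_event|exact: past_Z].
rewrite integral_mkcondr censored_restrict /surv_event setIC.
have cs0 w : (0 <= survival_censored lambda tstar (Z i w) tau)%R.
  by rewrite mulr_ge0// ltW// survival_gt0.
rewrite (@cond_prob_integral _ _ _ _ _ _ (past i) _ _ (Z k)
    (fun w => survival_censored lambda tstar (Z i w) tau))//.
- rewrite integral_mkcond; apply: eq_integral => w _.
  have := congr1 (@^~ w) (censored_restrict i).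
  by rewrite /= !patchE; case: ifPn => _ <- //; rewrite mul0e.
- exact: sigma_setI.
- by rewrite -[[set w | _]]setTI; apply: emeasurable_fun_o_infty => //; exact: measurable_S.
- exact: (S_law_past model).
- by move=> D mD; exact: past_Z.
- exact: past_Z.
Qed.

Lemma prob_surv_event_from x i : P \d_x (ev i) = iter i (kernel_act Q) h x.
Proof.
by rewrite prob_surv_event (markov_expectation (Z_markov model \d_x)).
Qed.

Lemma prob_surv_eventI_from x i n : (0 < n)%N ->
  P \d_x (ev i `&` ev (i + n)) =
  iter i (kernel_act Q) (fun z => h z * iter n (kernel_act Q) h z) x.
Proof.
move=> n0; rewrite prob_surv_eventI; last by rewrite -addn1 leq_add2l.
rewrite (markov_step_iter (Z_markov model \d_x))//.
have [mn p0] := measurable_kernel_act Q n mh h0.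
have hn1 := kernel_act_le1 Q n mh h01.
rewrite -(markov_expectation (Z_markov model \d_x))//.
  exact: emeasurable_funM.
move=> z; rewrite mule_ge0//=.
have /andP[_ h1] := h01 z.
by rewrite -[leRHS]mule1 lee_pmul.
Qed.

End jump_events.

(** * Convergence of survivor frequencies in mean square *)

Section frequency_of_events.
Context {d} {Om : measurableType d} {R : realType} (P : probability Om R).

Lemma integrable_cst_prob (c : R) : P.-integrable setT (EFin \o cst c).
Proof. exact: finite_measure_integrable_cst. Qed.

Lemma integrable_indic_prob (B : set Om) : measurable B ->
  P.-integrable setT (EFin \o \1_B).
Proof. by move=> mB; apply: integrable_indic. Qed.

Lemma Rintegral_indic (B : set Om) : measurable B ->
  \int[P]_w \1_B w = fine (P B).
Proof. by move=> mB; rewrite /Rintegral integral_indic// setIT. Qed.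

Lemma integrable_sum_seq (I : Type) (s : seq I) (g : I -> Om -> R) :
  (forall i, P.-integrable setT (EFin \o g i)) ->
  P.-integrable setT (EFin \o (fun w => \sum_(i <- s) g i w)).
Proof.
move=> ig; rewrite (_ : EFin \o _ = (fun w => \sum_(i <- s) (g i w)%:E)%E); last first.
  by apply/funext => w; rewrite /= sumEFin.
apply: integrable_sum => // i _; exact: ig.
Qed.

Lemma Rintegral_sum_seq (I : Type) (s : seq I) (g : I -> Om -> R) :
  (forall i, P.-integrable setT (EFin \o g i)) ->
  \int[P]_w (\sum_(i <- s) g i w) = \sum_(i <- s) \int[P]_w g i w.
Proof.
move=> ig; elim: s => [|i s IH].
  rewrite big_nil (_ : (fun w => _) = cst 0).
    by rewrite Rintegral_cst// mul0r.
  by apply/funext => w; rewrite big_nil.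
rewrite big_cons -IH -RintegralD//; last exact: integrable_sum_seq.
by apply: eq_Rintegral => w _; rewrite big_cons.
Qed.

Variables (B : nat -> set Om) (m : R).
Hypothesis mB : forall i, measurable (B i).

(** Expectation of the product of the centred indicators of [B i] and [B k], when
    [m] is used as the centring constant. *)
Definition centered_moment i k : R :=
  fine (P (B i `&` B k)) - m * fine (P (B i)) - m * fine (P (B k)) + m ^+ 2.

Definition mean_centered_moment n : R :=
  n%:R ^- 2 * \sum_(i < n) \sum_(k < n) centered_moment i k.

Let dev i w : R := \1_(B i) w - m.

Let integrable_dev i k : P.-integrable setT (EFin \o (fun w => dev i w * dev k w)).
Proof.
apply: measurable_bounded_integrable => //.
- by rewrite ltey_eq fin_num_measure.
- by apply: measurable_funM; apply: measurable_funB => //; exact: measurable_indic.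
- exists ((1 + `|m|) * (1 + `|m|)); split => [|M MC w _ /=]; first exact: num_real.
  apply/ltW/(le_lt_trans _ MC); rewrite normrM; apply: ler_pM => //;
    by rewrite (le_trans (ler_normB _ _))// lerD2r indicE ger0_norm// lern1 leq_b1.
Qed.

Let integral_dev i k :
  \int[P]_w (dev i w * dev k w) = centered_moment i k.
Proof.
have mI : measurable (B i `&` B k) by exact: measurableI.
have iI C : measurable C -> P.-integrable setT (EFin \o (fun w => m * \1_C w)).
  move=> mC; rewrite (_ : EFin \o _ = (fun w => m%:E * (\1_C w)%:E)%E)//.
  by apply: integrableZl => //; exact: integrable_indic_prob.
have i1 : P.-integrable setT
    (EFin \o (fun w => \1_(B i `&` B k) w - m * \1_(B i) w)).
  rewrite (_ : EFin \o _ = ((EFin \o \1_(B i `&` B k)) \-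
      (EFin \o (fun w => m * \1_(B i) w)%R))%E); last by apply/funext.
  by apply: integrableB => //; [exact: integrable_indic_prob|exact: iI].
have i2 : P.-integrable setT
    (EFin \o (fun w => \1_(B i `&` B k) w - m * \1_(B i) w - m * \1_(B k) w)).
  rewrite (_ : EFin \o _ = ((EFin \o (fun w => \1_(B i `&` B k) w - m * \1_(B i) w)%R) \-
      (EFin \o (fun w => m * \1_(B k) w)%R))%E); last by apply/funext.
  by apply: integrableB => //; exact: iI.
transitivity (\int[P]_w
    (\1_(B i `&` B k) w - m * \1_(B i) w - m * \1_(B k) w + cst (m ^+ 2) w)).
  by apply: eq_Rintegral => w _; rewrite /dev indicI /=; ring.
rewrite RintegralD ?RintegralB ?RintegralZl//; last 6 first.
all: try exact: integrable_indic_prob.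
all: try exact: integrable_cst_prob.
all: try exact: iI.
rewrite !Rintegral_indic// Rintegral_cst//=.
have -> : fine (P setT) = 1 by rewrite probability_setT.
by rewrite mulr1.
Qed.

Lemma chebyshev_frequency n (eta : R) : (0 < n)%N -> 0 < eta ->
  (P [set w | (eta < `|n%:R^-1 * (\sum_(i < n) \1_(B i) w) - m|)%R] <=
   (mean_centered_moment n / eta ^+ 2)%:E)%E.
Proof.
move=> n0 eta0; have n0' : 0 < n%:R :> R by rewrite ltr0n.
set C := [set w | _].
have mC : measurable C.
  rewrite -[C]setTI /C; under eq_set do rewrite -lte_fin.
  apply: emeasurable_fun_o_infty => //; apply/measurable_EFinP.
  apply: measurableT_comp => //; apply: measurable_funB => //.
  apply: measurable_funM => //; apply: measurable_sum => i.
  exact: measurable_indic.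
pose Y w : R := \sum_(i < n) \sum_(k < n) dev i w * dev k w.
have YE w : Y w = (n%:R * (n%:R^-1 * (\sum_(i < n) \1_(B i) w) - m)) ^+ 2.
  rewrite mulrBr mulVKf ?gt_eqF// /Y.
  under eq_bigr do rewrite -mulr_sumr.
  rewrite -mulr_suml -expr2; congr (_ ^+ 2).
  by rewrite sumrB sumr_const card_ord mulr_natl.
have iY i : P.-integrable setT (EFin \o (fun w => \sum_(k < n) dev i w * dev k w)).
  by apply: integrable_sum_seq => k; exact: integrable_dev.
have intY : \int[P]_w Y w = n%:R ^+ 2 * mean_centered_moment n.
  rewrite /mean_centered_moment mulVKf ?expf_neq0 ?gt_eqF// Rintegral_sum_seq//.
  apply: eq_bigr => i _; rewrite Rintegral_sum_seq//.
  by apply: eq_bigr => k _; rewrite integral_dev.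
have iYY : P.-integrable setT (EFin \o Y) by exact: integrable_sum_seq.
have iC : P.-integrable setT (EFin \o (fun w => (n%:R * eta) ^+ 2 * \1_C w)).
  rewrite (_ : EFin \o _ = (fun w => ((n%:R * eta) ^+ 2)%:E * (\1_C w)%:E)%E)//.
  by apply: integrableZl => //; exact: integrable_indic_prob.
have : \int[P]_w ((n%:R * eta) ^+ 2 * \1_C w) <= \int[P]_w Y w.
  apply: le_Rintegral => // w _; rewrite indicE YE.
  have [/set_mem Cw|_] := boolP (w \in C); last by rewrite mulr0 sqr_ge0.
  rewrite mulr1 -[leRHS]real_normK ?num_real//.
  apply: lerXn2r; rewrite ?nnegrE ?normr_ge0//.
    by rewrite mulr_ge0// ltW.
  by rewrite normrM (gtr0_norm n0') ler_wpM2l ?(ltW n0')//; exact: ltW.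
rewrite RintegralZl//; last exact: integrable_indic_prob.
rewrite Rintegral_indic// intY exprMn -mulrA ler_pM2l ?exprn_gt0// => H.
rewrite -[leLHS]fineK ?fin_num_measure// lee_fin ler_pdivlMr ?exprn_gt0//.
by rewrite mulrC.
Qed.

End frequency_of_events.

Section cesaro_double.
Context {R : realType}.

(** On each row the terms [u |i - k|] sum to at most twice the partial sum of
    [u], since each distance occurs at most twice; everything then reduces to
    ordinary Cesaro means. *)
Lemma cesaro_double (a : nat -> nat -> R) (u s : nat -> R) :
  (forall i, 0 <= u i) -> u @ \oo --> 0 -> s @ \oo --> 0 ->
  (forall i k, `|a i k| <= u ((i - k) + (k - i))%N + s i + s k) ->
  (fun n => n%:R ^- 2 * \sum_(i < n) \sum_(k < n) a i k) @ \oo --> 0.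
Proof.
move=> u0 cu cs aus.
(* The truncated differences add up to the distance between [i] and [k]. *)
have inner n i : (i < n)%N ->
    \sum_(k < n) u ((i - k) + (k - i))%N <= 2 * \sum_(0 <= k < n) u k.
  move=> iN; rewrite -(big_mkord xpredT (fun k => u ((i - k) + (k - i))%N)).
  rewrite (@big_cat_nat _ _ _ i)//=; last exact: ltnW.
  rewrite mulr_natl mulr2n; apply: lerD.
    have -> : \sum_(0 <= k < i) u ((i - k) + (k - i))%N = \sum_(1 <= k < i.+1) u k.
      rewrite big_nat_rev big_add1/=; apply: eq_big_nat => k /andP[_ ki].
      by congr u; lia.
    rewrite [leRHS](@big_cat_nat _ _ _ 1)//=; last by lia.
    rewrite (@big_cat_nat _ _ _ i.+1 1 n)//= addrCA lerDl addr_ge0//; exact: sumr_ge0.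
  rewrite -{1}[i]add0n big_addn.
  rewrite (@eq_big_nat _ _ _ 0 (n - i) _ u); last first.
    move=> k _; congr u; lia.
  by rewrite [leRHS](@big_cat_nat _ _ _ (n - i))//= ?leq_subr// lerDl sumr_ge0.
have bound N (n := N.+1) : `|n%:R ^- 2 * \sum_(i < n) \sum_(k < n) a i k| <=
    2 * (arithmetic_mean u N + arithmetic_mean s N).
  have n0' : 0 < n%:R :> R by rewrite ltr0n.
  rewrite normrM ger0_norm ?invr_ge0 ?sqr_ge0// ler_pdivrMl ?exprn_gt0//.
  apply: (@le_trans _ _ (\sum_(i < n) \sum_(k < n) (u ((i - k) + (k - i))%N + s i + s k))).
    apply: (le_trans (ler_norm_sum _ _ _)); apply: ler_sum => i _.
    by apply: (le_trans (ler_norm_sum _ _ _)); apply: ler_sum => k _.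
  under eq_bigr do rewrite !big_split/= sumr_const card_ord.
  rewrite !big_split/= sumr_const card_ord -sumrMnl.
  have -> : 2 * (arithmetic_mean u N + arithmetic_mean s N) =
    n%:R ^-1 * (2 * \sum_(0 <= k < n) u k) + n%:R^-1 * (2 * \sum_(i < n) s i).
    by rewrite /arithmetic_mean/= /series/= (big_mkord _ s); ring.
  rewrite mulrDr -addrA; apply: lerD.
    rewrite expr2 -mulrA mulVKf ?gt_eqF//.
    have -> : n%:R * (2 * \sum_(0 <= k < n) u k) =
        \sum_(i < n) (2 * \sum_(0 <= k < n) u k).
      by rewrite sumr_const card_ord -[RHS]mulr_natl.
    by apply: ler_sum => i _; exact: inner.
  rewrite expr2 -mulrA mulVKf ?gt_eqF//.
  rewrite (_ : \sum_(i < n) s i *+ n = n%:R * \sum_(i < n) s i); first by lra.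
  by rewrite [RHS]mulr_natl sumrMnl.
rewrite -cvg_shiftS; apply/cvgr0Pnorm_le => e e0.
have e4 : 0 < e / 4 by rewrite divr_gt0.
have Hu := cvgr0_norm_le _ (cesaro cu) _ e4.
have Hs := cvgr0_norm_le _ (cesaro cs) _ e4.
near=> n; rewrite (le_trans (bound n))//.
have h1 : `|arithmetic_mean u n| <= e / 4 by near: n; exact: Hu.
have h2 : `|arithmetic_mean s n| <= e / 4 by near: n; exact: Hs.
move: h1 h2; rewrite !ler_norml; lra.
Unshelve. all: by end_near. Qed.

End cesaro_double.
Section centered_bounds.
Context {R : realType}.
Implicit Types a b c m r t : R.

Lemma ler_dist01 a b : 0 <= a <= 1 -> 0 <= b <= 1 -> `|a - b| <= 1.
Proof. by move=> /andP[? ?] /andP[? ?]; rewrite ler_norml; lra. Qed.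

Lemma ler_centered m a b c r t t' : 0 <= m <= 1 -> `|c - m ^+ 2| <= r + t ->
  `|a - m| <= t -> `|b - m| <= t' -> 0 <= t -> 0 <= t' ->
  `|c - m * a - m * b + m ^+ 2| <= r + 2 * t + 2 * t'.
Proof.
move=> /andP[m0 m1] cr at_ bt' t0 t'0.
have H1 : `|m * (a - m)| <= t.
  by rewrite normrM (ger0_norm m0) -[leRHS]mul1r ler_pM.
have H2 : `|m * (b - m)| <= t'.
  by rewrite normrM (ger0_norm m0) -[leRHS]mul1r ler_pM.
move: cr H1 H2; rewrite !mulrBr !ler_norml expr2; lra.
Qed.

Lemma ler_centered_diag m a t : 0 <= m <= 1 -> 0 <= a <= 1 -> 0 <= t ->
  `|a - m * a - m * a + m ^+ 2| <= 4 + 2 * t + 2 * t.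
Proof. by move=> /andP[? ?] /andP[? ?] ?; rewrite ler_norml; nra. Qed.

End centered_bounds.

Section ergodic_frequency.
Context {R : realType} {X : metricType R} {E : set X} {e0 : E}.
Context {dO dF dD : measure_display} {Om : measurableType dO}
  {Fe : measurableType dF} {De : measurableType dD}.
Context {P : probability (state e0) R -> probability Om R}
  {Q : R.-pker (state e0) ~> (state e0)}
  {lambda : state e0 -> R -> R} {tstar : state e0 -> \bar R}
  {psi : state e0 * Fe -> state e0} {phi : state e0 * De -> \bar R}
  {eps : nat -> Om -> Fe} {delta : nat -> Om -> De}
  {Z : nat -> Om -> state e0} {S : nat -> Om -> \bar R}
  {nu : probability (state e0) R}.
Hypothesis model : renewal_model P Q lambda tstar psi phi eps delta Z S.
Hypothesis hl : jump_characteristics lambda tstar.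
Hypothesis Z_ergodic : ergodic P Z nu.
Variables (A : set (state e0)) (tau : R).
Hypotheses (mA : measurable A) (tau0 : 0 <= tau)
  (tauA : forall z, A z -> (tau%:E < tstar z)%E).

Let sf := surviving_from lambda A tau.
Let B := surv_event Z S A tau.
Let h (z : state e0) : \bar R := (sf z)%:E.
Let m : R := \int[nu]_z sf z.

Let mB i : measurable (B i). Proof. exact: (measurable_surv_event model). Qed.

Let msf : measurable_fun setT sf. Proof. exact: (measurable_surviving_from hl). Qed.

Let sf01 z : 0 <= sf z <= 1. Proof. exact: (surviving_from01 hl). Qed.

Let mh : measurable_fun setT h. Proof. by apply/measurable_EFinP. Qed.

Let h01 z : (0 <= h z <= 1)%E. Proof. by rewrite !lee_fin. Qed.

Let h0 z : (0 <= h z)%E. Proof. by have /andP[] := h01 z. Qed.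

Let Q_sf n z := fine (iter n (kernel_act Q) h z).

Let Q_sf_fin n z : (Q_sf n z)%:E = iter n (kernel_act Q) h z.
Proof.
rewrite fineK// ge0_fin_numE; last by have [] := measurable_kernel_act Q n mh h0.
by rewrite (le_lt_trans (kernel_act_le1 Q n mh h01 z))// ltry.
Qed.

Let Q_sf01 n z : 0 <= Q_sf n z <= 1.
Proof.
rewrite -!lee_fin Q_sf_fin (kernel_act_le1 Q n mh h01 z) andbT.
by have [] := measurable_kernel_act Q n mh h0.
Qed.

Let mQ_sf n : measurable_fun setT (Q_sf n).
Proof.
by apply: measurableT_comp => //; have [] := measurable_kernel_act Q n mh h0.
Qed.

Let fine_prob01 d (T : measurableType d) (Pr : probability T R) (D : set T) :
  measurable D -> 0 <= fine (Pr D) <= 1.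
Proof.
move=> mD; rewrite fine_ge0//= -lee_fin fineK ?probability_le1//.
exact: fin_num_measure.
Qed.

Let tv x i : R := fine (tv_dist (pushforward (P \d_x) (Z i)) nu).

Let tvP x i D : measurable D ->
  `|fine (P \d_x (Z i @^-1` D)) - fine (nu D)| <= tv x i.
Proof.
move=> mD; have mZ := measurable_Z model i.
have mZD D' : measurable D' -> measurable (Z i @^-1` D').
  by move=> mD'; rewrite -[_ @^-1` _]setTI; exact: mZ.
have fin D' : measurable D' ->
    `|pushforward (P \d_x) (Z i) D' - nu D'|%E =
    `|fine (P \d_x (Z i @^-1` D')) - fine (nu D')|%:E.
  move=> mD'; rewrite /pushforward -[in LHS](fineK (fin_num_measure nu _ mD')).
  by rewrite -[X in (X - _)%E]fineK ?fin_num_measure//; exact: mZD.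
have ub : (tv_dist (pushforward (P \d_x) (Z i)) nu <= 1)%E.
  apply: ge_ereal_sup => _ [D' mD' <-]; rewrite fin// lee_fin.
  by apply: ler_dist01; apply: fine_prob01 => //; exact: mZD.
have lb : (`|fine (P \d_x (Z i @^-1` D)) - fine (nu D)|%:E <=
    tv_dist (pushforward (P \d_x) (Z i)) nu)%E.
  by rewrite -fin//; apply: ereal_sup_ubound; exists D.
rewrite -lee_fin fineK// fin_numElt (le_lt_trans ub (ltry _)) andbT.
by apply: lt_le_trans lb; rewrite ltNyr.
Qed.

Let tv_cvg x : tv x i @[i --> \oo] --> 0.
Proof. by have /fine_cvgP[] := Z_ergodic x. Qed.

Let tv_expectation x i (p : state e0 -> R) : measurable_fun setT p ->
  (forall z, 0 <= p z <= 1) ->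
  `|fine (\int[P \d_x]_w (p (Z i w))%:E)%E - \int[nu]_z p z| <= tv x i.
Proof.
move=> mp p01; have mZ := measurable_Z model i.
pose mixin := @isMeasurableFun.Build _ _ _ _ (Z i) mZ.
pose Zi : {mfun Om >-> state e0} := HB.pack (Z i) mixin.
have -> : fine (\int[P \d_x]_w (p (Z i w))%:E)%E =
    \int[distribution (P \d_x) Zi]_z p z.
  congr fine; rewrite ge0_integral_distribution//.
    exact/measurable_EFinP.
  by move=> z; rewrite lee_fin; have /andP[] := p01 z.
by apply: tv_integral => // D mD; exact: tvP.
Qed.

Let m01 : 0 <= m <= 1.
Proof.
have im := integrable01 nu msf sf01.
rewrite /m Rintegral_ge0 => [|z _]; last by have /andP[] := sf01 z.
apply: (@le_trans _ _ (\int[nu]_z (cst 1 z))).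
  apply: le_Rintegral => //; first exact: finite_measure_integrable_cst.
  by move=> z _; have /andP[] := sf01 z.
by rewrite Rintegral_cst// mul1r -lee_fin fineK ?fin_num_measure ?probability_le1.
Qed.

Let Q_sf_cvg z n : `|Q_sf n z - m| <= tv z n.
Proof.
rewrite /Q_sf -(markov_expectation (Z_markov model \d_z))//.
exact: tv_expectation.
Qed.

Let rho n : R := \int[nu]_z `|Q_sf n z - m|.

Let rho_cvg : rho n @[n --> \oo] --> 0.
Proof.
have mdev n : measurable_fun setT (fun z => `|Q_sf n z - m|).
  by apply: measurableT_comp => //; exact: measurable_funB.
have [] := @dominated_convergence _ _ _ nu setT measurableT
  (fun n z => (`|Q_sf n z - m|)%:E) (cst 0%E) (cst 1%E).
- by move=> n; exact/measurable_EFinP.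
- exact: measurable_cst.
- apply: aeW => z _; apply: cvg_EFin; first exact: nearW.
  have := tv_cvg z; apply: squeeze_cvgr (cvg_cst 0).
  by apply: nearW => n; rewrite normr_ge0/=; exact: Q_sf_cvg.
- exact: finite_measure_integrable_cst.
- by apply: aeW => z n _; rewrite lee_fin normr_id ler_dist01.
move=> _ _; rewrite integral0; move/fine_cvgP => [_].
by [].
Qed.

Let prob_surv_near x i : `|fine (P \d_x (B i)) - m| <= tv x i.
Proof. by rewrite (prob_surv_event model mA tau0 tauA); exact: tv_expectation. Qed.

Let prob_survI_near x i n : (0 < n)%N ->
  `|fine (P \d_x (B i `&` B (i + n)%N)) - m ^+ 2| <= rho n + tv x i.
Proof.
move=> n0; have ik : (i < i + n)%N by rewrite -addn1 leq_add2l.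
rewrite (prob_surv_eventI model hl mA tau0 tauA)//.
rewrite (markov_step_iter (Z_markov model \d_x) i n mh h0 mh h01).
pose p z := sf z * Q_sf n z.
have mp : measurable_fun setT p by exact: measurable_funM.
have p01 z : 0 <= p z <= 1.
  have /andP[a0 a1] := sf01 z; have /andP[b0 b1] := Q_sf01 n z.
  by rewrite mulr_ge0//= -[leRHS]mulr1 ler_pM.
rewrite (eq_integral (fun w => (p (Z i w))%:E)); last first.
  by move=> w _; rewrite /p EFinM Q_sf_fin.
have H1 := tv_expectation x i mp p01.
suff H2 : `|\int[nu]_z p z - m ^+ 2| <= rho n.
  by apply: (le_trans (ler_distD (\int[nu]_z p z) _ _)); rewrite [leRHS]addrC lerD.
have isf := integrable01 nu msf sf01.
have ip := integrable01 nu mp p01.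
have imsf : nu.-integrable setT (EFin \o (fun z => m * sf z)).
  rewrite (_ : EFin \o _ = (fun z => m%:E * (sf z)%:E)%E)//.
  exact: integrableZl.
rewrite expr2 -[X in _ * X]/(\int[nu]_z sf z) -RintegralZl// -RintegralB//.
have idiff : nu.-integrable setT (EFin \o (fun z => p z - m * sf z)).
  rewrite (_ : EFin \o _ = ((EFin \o p) \- (EFin \o (fun z => m * sf z)%R))%E); last by apply/funext.
  exact: integrableB.
apply: le_trans (le_normr_Rintegral _ idiff) _ => //.
have /andP[mm0 mm1] := m01.
have irho : nu.-integrable setT (EFin \o (fun z => `|Q_sf n z - m|)).
  apply: integrable01.
    by apply: measurableT_comp => //; exact: measurable_funB.
  move=> z; have /andP[b0 b1] := Q_sf01 n z.
  by rewrite normr_ge0/= ler_dist01.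
apply: le_Rintegral => //; first exact: integrable_norm idiff.
move=> z _; have /andP[a0 a1] := sf01 z.
rewrite /p (mulrC m) -mulrBr normrM (ger0_norm a0).
by rewrite -[leRHS]mul1r ler_wpM2r.
Qed.

(** Two errors appear: mixing between times [i] and [i + n], measured by the mean
    [rho n] under [nu] of the distance between Q^n h and [m], and the distance
    [tv x i] of the law of Z_i to [nu]. Both vanish, the first one by dominated
    convergence. *)
Lemma mean_centered_moment_cvg x :
  mean_centered_moment (P \d_x) B m n @[n --> \oo] --> 0.
Proof.
(* On the diagonal there is no mixing to use; a constant suffices because the
diagonal is negligible in the double mean. *)
pose u n := if n is 0%N then 4 else rho n.
have rho0 n : 0 <= rho n by apply: Rintegral_ge0 => z _; exact: normr_ge0.
have tv0 i : 0 <= tv x i.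
  by apply: le_trans (tvP x i measurableT); exact: normr_ge0.
apply: (@cesaro_double _ _ u (fun i => 2 * tv x i)).
- by case => [|n] /=; [exact: ler0n|exact: rho0].
- rewrite -cvg_shiftS; rewrite [X in X @ _ --> _](_ : _ = fun n => rho n.+1)//.
  by rewrite cvg_shiftS; exact: rho_cvg.
- rewrite -(mulr0 2); apply: cvgM; [exact: cvg_cst|exact: tv_cvg].
have /andP[mm0 mm1] := m01.
have main i n : (0 < n)%N -> `|centered_moment (P \d_x) B m i (i + n)%N| <=
    rho n + 2 * tv x i + 2 * tv x (i + n)%N.
  move=> n0; have H1 := prob_survI_near x i n0.
  exact: ler_centered m01 H1 (prob_surv_near x i) (prob_surv_near x _) _ _.
have cmC i k : centered_moment (P \d_x) B m i k = centered_moment (P \d_x) B m k i.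
  by rewrite /centered_moment setIC; ring.
move=> i k; case: (ltngtP i k) => ik.
- have [n n0 ->] : exists2 n, (0 < n)%N & k = (i + n)%N 
    by exists (k - i)%N; rewrite ?subn_gt0// subnKC// ltnW.
  rewrite subnDA subnn sub0n add0n addKn.
  by case: n n0 => // n _; exact: main.
- have [n n0 ->] : exists2 n, (0 < n)%N & i = (k + n)%N 
    by exists (i - k)%N; rewrite ?subn_gt0// subnKC// ltnW.
  rewrite cmC addKn subnDA subnn sub0n addn0.
  by case: n n0 => // n _; rewrite addrAC; exact: main.
- rewrite ik subnn addn0 /= /centered_moment setIid.
  by apply: ler_centered_diag => //; exact: fine_prob01.
Qed.

(** The probabilities P_x are not assumed to depend measurably on [x]; the
    expressions through iterates of [Q] provide it. *)
Lemma measurable_mean_centered_moment n :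
  measurable_fun setT (fun x => mean_centered_moment (P \d_x) B m n).
Proof.
have mK k f : measurable_fun setT f -> (forall z, 0 <= f z)%E ->
    measurable_fun setT (fun x => fine (iter k (kernel_act Q) f x)).
  move=> mf f0; apply: measurableT_comp => //.
  by have [] := measurable_kernel_act Q k mf f0.
have m1 i : measurable_fun setT (fun x => fine (P \d_x (B i))).
  rewrite (_ : (fun _ => _) = fun x => fine (iter i (kernel_act Q) h x)).
    exact: mK.
  by apply/funext => x; rewrite (prob_surv_event_from model hl mA tau0 tauA).
have m2 i k : (i < k)%N -> measurable_fun setT (fun x => fine (P \d_x (B i `&` B k))).
  move=> ik; have [r r0 ->] : exists2 r, (0 < r)%N & k = (i + r)%N.

    by exists (k - i)%N; rewrite ?subn_gt0// subnKC// ltnW.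
  rewrite (_ : (fun _ => _) = fun x => fine (iter i (kernel_act Q)
      (fun z => h z * iter r (kernel_act Q) h z)%E x)).
    have [mr r0'] := measurable_kernel_act Q r mh h0.
    by apply: mK; [exact: emeasurable_funM|move=> z; exact: mule_ge0].
  by apply/funext => x; rewrite (prob_surv_eventI_from model hl mA tau0 tauA).
apply: measurable_funM => //; apply: measurable_sum => i; apply: measurable_sum => k.
apply: measurable_funD => //; apply: measurable_funB; last exact: measurable_funM.
apply: measurable_funB; last exact: measurable_funM.
case: (ltngtP i k) => ik; first exact: m2.
- by under eq_fun do rewrite setIC; exact: m2.
- by rewrite (val_inj ik); under eq_fun do rewrite setIid; exact: m1.
Qed.

End ergodic_frequency.

(** * Bandwidth, grid and tolerance *)

Section estimation_error.
Context {R : realType} {X : metricType R} {E : set X} {e0 : E}.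
Variables (lambda : state e0 -> R -> R) (tstar : state e0 -> \bar R).
Hypothesis hl : jump_characteristics lambda tstar.
Variables (nu : probability (state e0) R) (A : set (state e0)).
Hypotheses (mA : measurable A) (nuA : (0 < nu A)%E).
Variables (K : R -> R) (r1 r2 t : R).
Hypotheses (hK : smoothing_kernel K) (r1_gt0 : 0 < r1) (r12 : r1 < r2) (r2t : r2 < t).

Let l (u : R) : R := jump_limit lambda nu A u / surv_limit lambda nu A u.

Let cl : continuous l.
Proof.
move=> u; apply: cvgM; first exact: (continuous_jump_limit hl).
by apply: cvgV; [rewrite gt_eqF// (surv_limit_gt0 hl)|exact: (continuous_surv_limit hl)].
Qed.

(** The triple consists of the bandwidth, the number of bins and the tolerance on
    the survivor frequencies. *)
Lemma rate_est_uniform (e : R) : 0 < e -> exists bNeta : R * nat * R,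
  [/\ 0 < bNeta.1.1, bNeta.1.1 <= e, (0 < bNeta.1.2)%N, 0 < bNeta.2 &
    forall (z : nat -> state e0) (s : nat -> \bar R) n,
    (forall j, (j <= bNeta.1.2)%N ->
       `|surv_freq A z s n (j%:R * t / bNeta.1.2%:R) -
         surv_limit lambda nu A (j%:R * t / bNeta.1.2%:R)| <= bNeta.2) ->
    forall u, u \in `[r1, r2] ->
      `|rate_est A z s n K bNeta.1.1 t u - limit_rate lambda nu A u| <= e].
Proof.
move=> e_gt0; have e2 : 0 < e / 2 by rewrite divr_gt0.
have [b0 b0_gt0 b0P] := kernel_smoothing_cvg hK cl r1_gt0 r2t e2.
pose b := Num.min b0 e.
have b_gt0 : 0 < b by rewrite lt_min b0_gt0.
have t_gt0 : 0 < t := lt_trans (lt_trans r1_gt0 r12) r2t.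
have cJ : continuous (jump_limit lambda nu A) by exact: (continuous_jump_limit hl).
have cS : continuous (surv_limit lambda nu A) by exact: (continuous_surv_limit hl).
have [N [eta [N0 eta0 est]]] := rate_est_near_smoothed A cJ cS
  (jump_limit_ge0 hl nu A) (surv_limit_gt0 hl mA nuA)
  (surv_limit0_le1 hl nu mA) (integral_jump_limit hl nu mA) hK t_gt0 b_gt0 e2.
exists (b, N, eta); split => //=; first by rewrite ge_min lexx orbT.
move=> z s n close u ur.
have u0 : 0 <= u by move: ur; rewrite in_itv/= => /andP[ur1 _]; exact: le_trans (ltW r1_gt0) ur1.
rewrite limit_rateE// -/(l u).
have bb0 : b <= b0 by rewrite ge_min lexx.
apply: (le_trans (ler_distD (b^-1 * \int[lebesgue_measure]_(v in `]0, t])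
  (K ((u - v) / b) * l v)) _ _)).
rewrite (splitr e); apply: lerD; first exact: est.
exact: b0P.
Qed.

End estimation_error.

(** * Measurability of the error event *)

Section measurable_supremum.
Context {d} {Om : measurableType d} {R : realType}.

Lemma measurable_ltr_fun (f g : Om -> R) : measurable_fun setT f ->
  measurable_fun setT g -> measurable [set w | f w < g w].
Proof.
move=> mf mg; rewrite -[X in measurable X]setTI.
under eq_set do rewrite -lte_fin.
by apply: measurable_lte => //; exact/measurable_EFinP.
Qed.

(** [g] is continuous in [u] on the whole line, whereas [f], which agrees with it
    on the interval, is only controlled there. By continuity the supremum may be
    taken over a countable grid of the interval. *)
Lemma measurable_sup_itv (f g : Om -> R -> R) (r1 r2 e : R) : r1 < r2 ->
  (forall w u, u \in `[r1, r2] -> f w u = g w u) ->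
  (forall u, u \in `[r1, r2] -> measurable_fun setT (g ^~ u)) ->
  (forall w, continuous (g w)) -> (forall w u, 0 <= g w u) ->
  measurable [set w | (e%:E < `|ereal_sup [set (f w u)%:E | u in `[r1, r2]]|)%E].
Proof.
move=> r12 fg mg cg g0.
have fgE w : [set (f w u)%:E | u in `[r1, r2]] = [set (g w u)%:E | u in `[r1, r2]].
  by apply: eq_imagel => u /= ur; rewrite fg.
under eq_set do rewrite fgE.
have r21 : 0 < r2 - r1 by rewrite subr_gt0.
(* The subdivision of [[r1, r2]] into [k.+1] equal parts, so that the end points
are included; indices beyond [k.+1] are sent to [r1]. *)
pose p (k j : nat) : R := if (j <= k.+1)%N then r1 + (r2 - r1) * (j%:R / k.+1%:R) else r1.
have pI k j : p k j \in `[r1, r2].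
  rewrite /p; case: ifPn => [jk|_]; rewrite in_itv/=; last by rewrite lexx/= ltW.
  have q0 : 0 <= j%:R / k.+1%:R :> R by rewrite divr_ge0.
  have q1 : j%:R / k.+1%:R <= 1 :> R by rewrite ler_pdivrMr ?mul1r ?ler_nat.
  apply/andP; split; first by rewrite lerDl mulr_ge0// ltW.
  by rewrite -lerBrDl ler_piMr// ltW.
have -> : [set w | (e%:E < `|ereal_sup [set (g w u)%:E | u in `[r1, r2]]|)%E] =
    \bigcup_k \bigcup_j [set w | e < g w (p k j)].
  apply/seteqP; split => w /=.
  - have sup0 : (0 <= ereal_sup [set (g w u)%:E | u in `[r1, r2]])%E.
      apply: (@le_trans _ _ (g w r1)%:E); first by rewrite lee_fin.
      by apply: ereal_sup_ubound; exists r1 => //=; rewrite in_itv/= lexx ltW.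
    rewrite gee0_abs// => /ereal_sup_gt[_ [u /= ur <-]]; rewrite lte_fin => egu.
    have ge0 : 0 < g w u - e by rewrite subr_gt0.
    have /cvgrPdist_lt/(_ _ ge0)/nbhs_ballP[r /= r0 rP] := cg w u.
    pose k := Num.truncn ((r2 - r1) / r).
    have kr : (r2 - r1) / k.+1%:R < r.
      by rewrite ltr_pdivrMr// mulrC -ltr_pdivrMr// truncnS_gt.
    pose y := (u - r1) / (r2 - r1) * k.+1%:R.
    move: ur; rewrite in_itv/= => /andP[ru1 ru2].
    have y0 : 0 <= y by rewrite mulr_ge0// divr_ge0 ?subr_ge0// ltW.
    pose j := Num.truncn y.
    have /andP[j1 j2] : j%:R <= y < j.+1%:R by exact: truncn_itv.
    have jk : (j <= k.+1)%N.
      rewrite -(ler_nat R) (le_trans j1)// ler_piMl//.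
      by rewrite ler_pdivrMr// mul1r lerD2r.
    exists k => //; exists j => //=; rewrite /p jk.
    set v := r1 + _.
    have uE : u = r1 + (r2 - r1) * (y / k.+1%:R).
      by rewrite /y; field; rewrite !gt_eqF.
    have uv : `|u - v| < r.
      rewrite uE /v opprD addrACA subrr add0r -mulrBr -mulrBl mulrCA.
      rewrite normrM (gtr0_norm (_ : 0 < _ / _)) ?divr_gt0//.
      apply: le_lt_trans kr; rewrite -[leRHS]mul1r ler_wpM2r//.
        by rewrite divr_ge0// ltW.
      by move: j1 j2; rewrite -natr1 ler_norml; lra.
    have := rP _ uv; rewrite ltr_norml => /andP[_]; lra.
  - move=> [k _ [j _ /= egp]].
    apply: (@lt_le_trans _ _ (ereal_sup [set (g w u)%:E | u in `[r1, r2]])); last exact: lee_abs.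
    apply: (@lt_le_trans _ _ (g w (p k j))%:E); first by rewrite lte_fin.
    by apply: ereal_sup_ubound; exists (p k j) => //=; exact: pI.
apply: bigcupT_measurable => k; apply: bigcupT_measurable => j.
by apply: measurable_ltr_fun => //; exact: mg.
Qed.

End measurable_supremum.

Lemma measurable_invr {R : realType} : measurable_fun setT (@GRing.inv R).
Proof.
have o0 : open [set x : R | x != 0].
  rewrite (_ : [set x | _] = ~` [set 0]); last first.
    by apply/seteqP; split => x /= /eqP.
  by apply: closed_openC; exact: closed_eq.
rewrite -(setUv [set 0 : R]) (_ : ~` [set 0] = [set x : R | x != 0]); last first.
  by apply/seteqP; split => x /= /eqP.
apply/measurable_funU => //; first exact: open_measurable.
split; first exact: measurable_fun_set1.
apply: open_continuous_measurable_fun => // x /set_mem/= x0.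
exact: inv_continuous.
Qed.

Section measurable_estimator.
Context {d d'} {Om : measurableType d} {T : measurableType d'} {R : realType}.
Variables (A : set T) (Z : nat -> Om -> T) (S : nat -> Om -> \bar R) (K : R -> R).
Hypotheses (mA : measurable A) (mZ : forall n, measurable_fun setT (Z n))
  (mS : forall n, measurable_fun setT (S n)) (cK : continuous K).

Lemma at_risk_invE (z : nat -> T) (s : nat -> \bar R) n x :
  at_risk_inv A z s n x = (at_risk A z s n x)^-1.
Proof. by rewrite /at_risk_inv; case: eqP => //= ->; rewrite invr0. Qed.

Let m1A i : measurable_fun setT (fun w => \1_A (Z i w) : R).
Proof. by apply: measurableT_comp => //; exact: measurable_indic. Qed.

Let mfine i : measurable_fun setT (fun w => fine (S i w)).
Proof. exact: measurableT_comp. Qed.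

Let measurable_bool (b : Om -> bool) : measurable [set w | b w] ->
  measurable_fun setT (fun w => (b w)%:R : R).
Proof.
move=> mb; rewrite (_ : (fun _ => _) = \1_[set w | b w]).
  exact: measurable_indic.
by apply/funext => w; rewrite indicE; congr (nat_of_bool _)%:R;
  apply/idP/idP => [|/set_mem//] ?; exact/mem_set.
Qed.

(** The at-risk count is evaluated at the random times S_(i+1), hence the
    comparison of S_(i+1) with all the S_(k+1). *)
Lemma measurable_rate_est (beta : Om -> R) n t u : measurable_fun setT beta ->
  measurable_fun setT (fun w => rate_est A (Z^~ w) (S^~ w) n K (beta w) t u).
Proof.
move=> mbeta; have mK := continuous_measurable_fun cK.
have mV (f : Om -> R) : measurable_fun setT f -> measurable_fun setT (fun w => (f w)^-1).
  by move=> mf; exact: (measurableT_comp measurable_invr).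
under eq_fun do rewrite rate_estE//.
apply: measurable_funM; first exact: mV.
apply: measurable_sum => i; apply: measurable_funM; last first.
  apply: measurableT_comp => //; apply: measurable_funM; last exact: mV.
  by apply: measurable_funB => //; exact: mfine.
apply: measurable_funM.
  apply: measurable_funM; first exact: m1A.
  apply: measurable_bool.
  rewrite (_ : [set w | _] = S i.+1 @^-1` `]0%E, t%:E]%classic).
    by rewrite -[_ @^-1` _]setTI; apply: mS => //; exact: emeasurable_itv.
  by apply/seteqP; split => w /=; rewrite in_itv.
under eq_fun do rewrite at_risk_invE.
apply: mV; apply: measurable_sum => k; apply: measurable_funM; last exact: m1A.
apply: measurable_bool; rewrite -[[set w | _]]setTI.
apply: measurable_lee => //; apply/measurable_EFinP; exact: mfine.
Qed.

Lemma continuous_rate_est (z : nat -> T) (s : nat -> \bar R) n (b t : R) :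
  continuous (fun u => rate_est A z s n K b t u).
Proof.
have mK := continuous_measurable_fun cK.
rewrite (_ : (fun u => _) = (fun u => b^-1 * \sum_(i < n)
    \1_A (z i) * (0 < s i.+1 <= t%:E)%E%:R
      * at_risk_inv A z s n (fine (s i.+1)) * K ((u - fine (s i.+1)) / b))).
  move=> u; apply: cvgM; first exact: cvg_cst.
  apply: cvg_big => [|i _]; first exact: add_continuous.
  apply: cvgM; first exact: cvg_cst.
  apply: continuous_comp; last exact: cK.
  apply: cvgM; last exact: cvg_cst.
  by apply: cvgB; [exact: cvg_id|exact: cvg_cst].
by apply/funext => u; rewrite rate_estE.
Qed.

End measurable_estimator.

(** * Choice of the bandwidth *)

Section diagonal_selection.
Context {d} {T : measurableType d} {R : realType}.

(** Among the levels [k <= n], the smallest [b k] whose criterion [W k n x] has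
    passed below [1 / k.+1]. Every level passes eventually, so [beta]
    tends to 0; and a small value of [beta] can only come from a large level.
    A minimum of finitely many measurable functions is measurable, which a
    selection of the level itself would not give as directly. *)
Lemma diagonal_selection (b : nat -> R) (W : nat -> nat -> T -> R) :
  (forall k, 0 < b k) -> (forall k, b k <= k.+1%:R^-1) ->
  (forall k n, measurable_fun setT (W k n)) ->
  (forall k x, W k n x @[n --> \oo] --> 0) ->
  exists beta : nat -> T -> R,
    [/\ forall n, measurable_fun setT (beta n), forall n x, 0 < beta n x,
        forall x, beta n x @[n --> \oo] --> 0 &
        forall x k0, \forall n \near \oo,
          exists k, [/\ (k0 <= k)%N, beta n x = b k & W k n x <= k.+1%:R^-1]].
Proof.
move=> b0 bk mW cW.
pose c k n x := if W k n x <= k.+1%:R^-1 then b k else 1.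
pose beta n x := \big[Num.min/1]_(k < n.+1) c k n x.
have beta_gt0 n x : 0 < beta n x.
  apply: lt_bigmin => // k _; rewrite /c; by case: ifP.
have betaE n x : beta n x = 1 \/ exists2 k, beta n x = b k & W k n x <= k.+1%:R^-1.
  rewrite /beta; elim/big_ind : _ => [||k _]; first by left.
  - by move=> u v Hu Hv; rewrite minEle; case: ifP.
  - rewrite /c; case: ifP => [Wk|_]; last by left.
    by right; exists k.
have cbeta x : beta n x @[n --> \oo] --> 0.
  apply/cvgr0Pnorm_le => e e0.
  pose k := Num.truncn e^-1.
  have ke : k.+1%:R^-1 <= e.
    by rewrite invf_ple ?posrE//; apply/ltW/truncnS_gt.
  have k0 : 0 < k.+1%:R^-1 :> R by rewrite invr_gt0.
  have Wk := cvgr0_norm_le _ (cW k x) _ k0.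
  near=> n; rewrite gtr0_norm//; apply: le_trans ke.
  have kn : (k < n.+1)%N by rewrite ltnS; near: n; exact: nbhs_infty_ge.
  have Wkn : W k n x <= k.+1%:R^-1.
    by rewrite (le_trans (ler_norm _))//; near: n; exact: Wk.
  apply: le_trans (bk k); rewrite /beta.
  apply: le_trans (bigmin_le _ (Ordinal kn) _) _.
  by rewrite /c /= Wkn.
exists beta; split => //.
- move=> n; have gen m (f : nat -> T -> R) : (forall k, measurable_fun setT (f k)) ->
      measurable_fun setT (fun x => \big[Num.min/1]_(k < m) f k x).
    elim: m f => [|m IH] f mf.
      by under eq_fun do rewrite big_ord0; exact: measurable_cst.
    under eq_fun do rewrite big_ord_recl/=.
    apply: measurable_minr => //.
    exact: (IH (fun k => f k.+1) (fun k => mf k.+1)).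
  apply: (gen n.+1 (fun k => c k n)) => k; apply: measurable_fun_ifT => //.
  exact: measurable_fun_ler.
- move=> x k0.
  (* Below [mu] the bandwidth is neither the default 1 nor any of the first [k0]
  levels. *)
  pose mu : R := \big[Num.min/1]_(k < k0) b k.
  have mu0 : 0 < mu by apply: lt_bigmin.
  have mu1 : mu <= 1 by exact: bigmin_le_id.
  have near_mu := cvgr0_norm_lt _ (cbeta x) _ mu0.
  near=> n; have : `|beta n x| < mu by near: n; exact: near_mu.
  rewrite gtr0_norm// => betamu.
  have [beta1|[k bE Wk]] := betaE n x.
    by move: betamu; rewrite beta1 ltNge mu1.
  exists k; split => //; rewrite leqNgt; apply/negP => kk0.
  have := bigmin_le 1 (Ordinal kk0) (fun k : 'I_k0 => b k).
  by rewrite leNgt/= -bE betamu.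
Unshelve. all: by end_near. Qed.

End diagonal_selection.

(** * The theorem *)

Section state_points.
Context {R : realType} {X : metricType R} {E : set X} {e0 : E}.

(** A singleton is the zero set of the distance to its point. *)
Lemma measurable_state1 (x : state e0) : measurable [set x].
Proof.
pose g (y : state e0) := mdist (point_of x) (point_of y).
have mg : measurable_fun setT g.
  apply: measurable_state; apply: (@continuous_state _ _ _ _ _ 1) => y y'.
  have H1 := metric_triangle (point_of x) (point_of y') (point_of y).
  have H2 := metric_triangle (point_of x) (point_of y) (point_of y').
  rewrite mul1r /g ler_norml; move: H1 H2.
  rewrite (metric_sym (point_of y') (point_of y)); lra.
rewrite (_ : [set x] = g @^-1` [set 0]).
  by rewrite -[_ @^-1` _]setTI; exact: mg.
apply/seteqP; split => y /=; first by move=> ->; rewrite /g mdistxx.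
move=> /mdist_positivity xy; apply/esym; exact: val_inj.
Qed.

End state_points.

Lemma surv_limitE {R : realType} {X : metricType R} {E : set X} {e0 : E}
    (lambda : state e0 -> R -> R) (nu : probability (state e0) R) A tau :
  \int[nu]_z surviving_from lambda A tau z = surv_limit lambda nu A tau.
Proof.
rewrite /surv_limit [RHS]Rintegral_mkcond; apply: eq_Rintegral => z _.
rewrite patchE /surviving_from indicE.
by case: ifPn => _; rewrite ?mul1r ?mul0r.
Qed.

Lemma surv_freqE {R : realType} {T Om : Type} (A : set T) (Z : nat -> Om -> T)
    (S : nat -> Om -> \bar R) n tau w :
  surv_freq A (Z^~ w) (S^~ w) n tau =
  n%:R^-1 * \sum_(i < n) \1_(surv_event Z S A tau i) w.
Proof.
congr (_ * _); apply: eq_bigr => i _; rewrite /surv_event indicI.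
congr (_ * _); rewrite indicE; congr (nat_of_bool _)%:R.
by apply/idP/idP => [|/set_mem//] ?; exact/mem_set.
Qed.

Theorem proposition4p26 (R : realType)
  (X : metricType R) (sepX : separable X)
  (E : set X) (oE : open E) (e0 : E)
  (dO dF dD : measure_display)
  (Om : measurableType dO) (Fe : measurableType dF) (De : measurableType dD)
  (P : probability (state e0) R -> probability Om R)
  (Q : R.-pker (state e0) ~> (state e0))
  (lambda : state e0 -> R -> R) (tstar : state e0 -> \bar R)
  (psi : state e0 * Fe -> state e0) (phi : state e0 * De -> \bar R)
  (eps : nat -> Om -> Fe) (delta : nat -> Om -> De)
  (Z : nat -> Om -> state e0) (S : nat -> Om -> \bar R)
  (nu : probability (state e0) R) (K : R -> R)
  (model : renewal_model P Q lambda tstar psi phi eps delta Z S)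
  (characteristics : jump_characteristics lambda tstar)
  (Q_diffuse : diffuse Q)
  (Z_ergodic : ergodic P Z nu)
  (K_kernel : smoothing_kernel K)
  (A : set (state e0)) (hA : Bplus nu A)
  (r1 r2 t : R) (r1_gt0 : 0 < r1) (r12 : r1 < r2) (r2t : r2 < t)
  (tA : (t%:E < tstar_inf tstar A)%E) :
  exists beta : nat -> Om -> R,
    [/\ forall n, measurable_fun setT (beta n),
        forall n w, 0 < beta n w &
        forall x : state e0,
          {ae P (\d_x : probability (state e0) R),
             forall w, beta n w @[n --> \oo] --> 0} /\
          cvg_in_probability0 (P (\d_x : probability (state e0) R))
            (fun n w => ereal_sup
               [set `| rate_est A (Z^~ w) (S^~ w) n K (beta n w) t u
                       - limit_rate lambda nu A u |%:E
                 | u in `[r1, r2]])].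
Proof.
have [mA _ nuA _] := hA.
have mZ := measurable_Z model; have mS := measurable_S model.
have cK : continuous K by case: K_kernel.
have t0 : 0 < t := lt_trans (lt_trans r1_gt0 r12) r2t.
have tauA tau : tau <= t -> forall z, A z -> (tau%:E < tstar z)%E.
  move=> taut z Az; apply: (@le_lt_trans _ _ t%:E); first by rewrite lee_fin.
  by apply: (lt_le_trans tA); apply: ereal_inf_lbound; exists z.
have inv0 k : 0 < k.+1%:R^-1 :> R by rewrite invr_gt0.
have /choice[sel selP] := fun k =>
  rate_est_uniform characteristics mA nuA K_kernel r1_gt0 r12 r2t (inv0 k).
pose b k := (sel k).1.1; pose N k := (sel k).1.2; pose eta k := (sel k).2.
have eta0 k : 0 < eta k by case: (selP k).
pose tau k j : R := j%:R * t / (N k)%:R.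
have tau0 k j : 0 <= tau k j by rewrite /tau !mulr_ge0 ?invr_ge0// ltW.
have taut k j : (j < (N k).+1)%N -> tau k j <= t.
  move=> jN; have N0 : (0 < N k)%N by case: (selP k).
  rewrite /tau mulrAC ler_piMl// ?(ltW t0)// ler_pdivrMr ?ltr0n// mul1r ler_nat.
  exact: jN.
(* Chebyshev's bound for the probability under P_x that one of the grid
frequencies of level [k] is further than [eta k] from its limit. *)
pose W k n x : R := \sum_(j < (N k).+1)
  mean_centered_moment (P \d_x) (surv_event Z S A (tau k j))
    (surv_limit lambda nu A (tau k j)) n / eta k ^+ 2.
have mW k n : measurable_fun setT (W k n).
  apply: measurable_sum => j; apply: measurable_funM => //.
  rewrite -surv_limitE.
  by apply: (measurable_mean_centered_moment model characteristics) => //;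
    [exact: tauA (taut k j (ltn_ord j))].
have cW k x : W k n x @[n --> \oo] --> 0.
  have -> : 0 = \sum_(j < (N k).+1) 0 / eta k ^+ 2 :> R.
    by rewrite big1// => j _; rewrite mul0r.
  apply: cvg_big => [|j _]; first exact: add_continuous.
  apply: cvgM; last exact: cvg_cst.
  rewrite -surv_limitE.
  apply: (mean_centered_moment_cvg model characteristics Z_ergodic) => //.
  exact: tauA (taut k j (ltn_ord j)).
have b0 k : 0 < b k by case: (selP k).
have bk k : b k <= k.+1%:R^-1 by case: (selP k).
have [beta [mbeta beta0 cbeta betaP]] := diagonal_selection b0 bk mW cW.
exists (fun n w => beta n (Z 0%N w)); split.
- by move=> n; exact: measurableT_comp.
- by move=> n w; exact: beta0.
move=> x.
have mZx : measurable (Z 0%N @^-1` (~` [set x])).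
  rewrite -[_ @^-1` _]setTI; apply: mZ => //.
  by apply: measurableC; exact: measurable_state1.
have Zx : P \d_x (Z 0%N @^-1` (~` [set x])) = 0%E.
  have [_ Z0 _] := Z_markov model \d_x.
  have mx : measurable (~` [set x]) by apply: measurableC; exact: measurable_state1.
  have dx : @dirac _ _ x R (~` [set x]) = 0%E.
    by rewrite diracE memNset//= => /(_ erefl).
  exact: etrans (Z0 _ mx) dx.
split.
  exists (Z 0%N @^-1` (~` [set x])); split => // w /= nw Zw.
  by apply: nw; rewrite Zw; exact: cbeta.
move=> e e_gt0.
pose err n w := ereal_sup [set `|rate_est A (Z^~ w) (S^~ w) n K (beta n (Z 0%N w)) t u
   - limit_rate lambda nu A u|%:E | u in `[r1, r2]].
have merr n : measurable [set w | (e%:E < `|err n w|)%E].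
  pose l u := jump_limit lambda nu A u / surv_limit lambda nu A u.
  have cl : continuous l.
    move=> u; apply: cvgM; first exact: (continuous_jump_limit characteristics).
    by apply: cvgV; [rewrite gt_eqF// (surv_limit_gt0 characteristics)|
      exact: (continuous_surv_limit characteristics)].
  pose g w u := `|rate_est A (Z^~ w) (S^~ w) n K (beta n (Z 0%N w)) t u - l u|.
  pose f w u := `|rate_est A (Z^~ w) (S^~ w) n K (beta n (Z 0%N w)) t u
    - limit_rate lambda nu A u|.
  have fg w u : u \in `[r1, r2] -> f w u = g w u.
    rewrite in_itv/= => /andP[ru _]; rewrite /f limit_rateE//.
    exact: le_trans (ltW r1_gt0) ru.
  have mg u : u \in `[r1, r2] -> measurable_fun setT (g ^~ u).
    move=> _; apply: measurableT_comp => //; apply: measurable_funB => //.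
    by apply: measurable_rate_est => //; exact: measurableT_comp.
  have cg w : continuous (g w).
    move=> u; apply: cvg_norm.
    by apply: cvgB; [exact: continuous_rate_est|exact: cl].
  have g0 w u : 0 <= g w u by exact: normr_ge0.
  exact: (measurable_sup_itv e r12 fg mg cg g0).
have bound n k : (0 < n)%N -> k.+1%:R^-1 <= e -> beta n x = b k ->
    (P \d_x [set w | (e%:E < `|err n w|)%E] <= (W k n x)%:E)%E.
  move=> n0 ke betab.
  pose C j := [set w | eta k < `|n%:R^-1 *
    (\sum_(i < n) \1_(surv_event Z S A (tau k j) i) w) -
    surv_limit lambda nu A (tau k j)|].
  have mC j : measurable (C j).
    apply: measurable_ltr_fun => //; apply: measurableT_comp => //.
    apply: measurable_funB => //; apply: measurable_funM => //.
    apply: measurable_sum => i; apply: measurable_indic.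
    exact: (measurable_surv_event model).
  (* Off the null set where [Z 0] differs from [x], the bandwidth is the constant
  [b k], so the deterministic bound applies. *)
  have sub : [set w | (e%:E < `|err n w|)%E] `<=`
      Z 0%N @^-1` (~` [set x]) `|` \big[setU/set0]_(j < (N k).+1) C j.
    move=> w /= ew; apply: contrapT => /not_orP[/contrapT Zw nC].
    have close j : (j <= N k)%N ->
       `|surv_freq A (Z^~ w) (S^~ w) n (tau k j) - surv_limit lambda nu A (tau k j)| <= eta k.
      move=> jN; rewrite leNgt; apply/negP => far; apply: nC.
      rewrite -bigcup_mkord; exists j => //=.
      by rewrite /C /= -surv_freqE.
    have [_ _ _ _ est] := selP k.
    move: ew; apply/negP; rewrite -leNgt gee0_abs; last first.
      apply: (@le_trans _ _ (`|rate_est A (Z^~ w) (S^~ w) n K (beta n (Z 0%N w)) t r1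
        - limit_rate lambda nu A r1|%:E)); first by rewrite lee_fin.
      by apply: ereal_sup_ubound; exists r1 => //=; rewrite in_itv/= lexx ltW.
    apply: ge_ereal_sup => _ [u /= ur <-]; rewrite lee_fin Zw betab.
    by apply: le_trans ke; exact: est.
  apply: (@le_trans _ _ (P \d_x (Z 0%N @^-1` (~` [set x]) `|`
      \big[setU/set0]_(j < (N k).+1) C j))).
    apply: le_measure => //; apply/mem_set; first exact: merr.
    by apply: measurableU => //; exact: bigsetU_measurable.
  apply: (@le_trans _ _ (P \d_x (Z 0%N @^-1` (~` [set x])) +
      P \d_x (\big[setU/set0]_(j < (N k).+1) C j))%E).
    by apply: measureU2 => //; exact: bigsetU_measurable.
  rewrite Zx add0e; apply: (le_trans (Boole_inequality _ _)) => //.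
  rewrite -sumEFin; apply: lee_sum => j _.
  apply: chebyshev_frequency => // i.
  exact: (measurable_surv_event model).
apply/fine_cvgP; split.
  by near=> n; apply: fin_num_measure; exact: merr.
apply/cvgr0Pnorm_le => eps' eps'0.
pose k0 := maxn (Num.truncn e^-1) (Num.truncn eps'^-1).
have inv_le (y : R) k : 0 < y -> (Num.truncn y^-1 <= k)%N -> k.+1%:R^-1 <= y.
  move=> y0 yk; rewrite invf_ple ?posrE//; apply/ltW.
  by apply: lt_le_trans (truncnS_gt _) _; rewrite ler_nat.
near=> n.
have n0 : (0 < n)%N by near: n; exact: nbhs_infty_gt.
have [k [k0k betab Wk]] : exists k, [/\ (k0 <= k)%N, beta n x = b k &
    W k n x <= k.+1%:R^-1] by near: n; exact: betaP.
have ke : k.+1%:R^-1 <= e.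
  by apply: inv_le => //; rewrite (leq_trans _ k0k)// leq_maxl.
have ke' : k.+1%:R^-1 <= eps'.
  by apply: inv_le => //; rewrite (leq_trans _ k0k)// leq_maxr.
rewrite ger0_norm ?fine_ge0//; apply: le_trans ke'; apply: le_trans Wk.
rewrite -lee_fin fineK; first exact: bound.
by apply: fin_num_measure; exact: merr.
Unshelve. all: by end_near. Qed.
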